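(* Let $\mathcal{C}$ be a full trio. The following are equivalent: (i) Safety is decidable for asynchronous programs over $\mathcal{C}$. (ii) Termination is decidable for asynchronous programs over $\mathcal{C}$. (iii) Emptiness is decidable for $\mathcal{C}$ (given a representation of a language $L$ in $\mathcal{C}$, decide whether $L=\emptyset$).
   Context: Language classes. A language class is a collection of languages over finite alphabets together with some finite representation of its languages. A full trio is a language class closed under intersection with regular languages, homomorphic images, and inverse homomorphic images. All full trios are assumed to be effective: given (a representation of) a language $L$ from $\mathcal{C}$, a regular language $R$ and a homomorphism $h$, one can compute representations in $\mathcal{C}$ of $L\cap R$, $h(L)$ and $h^{-1}(L)$. Decidability for $\mathcal C$ means that the input languages are given by their representations. Multisets. $\mathbb{M}[\Sigma]$ is the set of multisets $\mathbf{m}\colon\Sigma\to\mathbb{N}$; $\oplus$ is pointwise addition; $[\![\sigma]\!]$ is the multiset containing $\sigma$ exactly once. For $w\in\Sigma^*$, $\mathsf{Parikh}(w)\in\mathbb{M}[\Sigma]$ maps each letter to its number of occurrences in $w$. Asynchronous programs. An asynchronous program over $\mathcal{C}$ is a tuple $\mathfrak{P}=(D,\Sigma,(L_c)_{c\in\mathfrak{C}},d_0,\mathbf{m}_0)$, where $D$ is a finite set of global states, $\Sigma$ is a finite alphabet of handler names, $\mathfrak{C}=D\times\Sigma\times D$ is the set of contexts, each $L_c\subseteq\Sigma^*$ is a language from $\mathcal{C}$, $d_0\in D$ is the initial state, and $\mathbf{m}_0\in\mathbb{M}[\Sigma]$. Configurations are pairs $(d,\mathbf{m})\in D\times\mathbb{M}[\Sigma]$;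 the initial configuration is $(d_0,\mathbf{m}_0)$. Transitions: $(d,\mathbf{m}\oplus[\![\sigma]\!])\xrightarrow{\sigma}(d',\mathbf{m}\oplus\mathbf{m}')$ iff there is $w\in L_{(d,\sigma,d')}$ with $\mathsf{Parikh}(w)=\mathbf{m}'$. A run is a finite or infinite sequence $(d_0,\mathbf{m}_0)\xrightarrow{\sigma_1}(d_1,\mathbf{m}_1)\xrightarrow{\sigma_2}\cdots$ of transitions starting in the initial configuration. A configuration is reachable if it occurs on some run. Problems. Safety: given an asynchronous program $\mathfrak{P}$ and $d_f\in D$, is there a reachable configuration with global state $d_f$? Termination: given $\mathfrak{P}$, are all runs of $\mathfrak{P}$ finite? *)

(* Defs.v *)
From HB Require Import structures.
From mathcomp Require Import all_boot.

Set Implicit Arguments.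
Unset Strict Implicit.
Unset Printing Implicit Defensive.

(* Computability: Kleene's partial mu-recursive functions.  Arguments are
   given as a list and arities are left implicit: [Zero] is constant at every
   arity, and [Proj i] is defined whenever there are more than [i] arguments. *)
Inductive recfun : Type :=
| Zero
| Succ
| Proj of nat
| Comp of recfun & seq recfun
| Rec of recfun & recfun
| Mu of recfun.

(* [eval f xs y]: the partial function denoted by [f] is defined at [xs], with
   value [y].  In the [Rec] case, [v i] is the value at recursion argument [i]. *)
Fixpoint eval (f : recfun) (xs : seq nat) (y : nat) {struct f} : Prop :=
  match f with
  | Zero => y = 0
  | Succ => if xs is [:: x] then y = x.+1 else False
  | Proj i => i < size xs /\ y = nth 0 xs i
  | Comp g hs =>
      exists zs : seq nat,
        (fix evals (hs : seq recfun) (zs : seq nat) {struct hs} : Prop :=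
           match hs, zs with
           | [::], [::] => True
           | h :: hs', z :: zs' => eval h xs z /\ evals hs' zs'
           | _, _ => False
           end) hs zs /\ eval g zs y
  | Rec g h =>
      if xs is n :: xs' then
        exists v : nat -> nat,
          [/\ eval g xs' (v 0),
              forall i, i < n -> eval h (i :: v i :: xs') (v i.+1)
            & y = v n]
      else False
  | Mu g =>
      eval g (y :: xs) 0 /\
      forall i, i < y -> exists z, eval g (i :: xs) z.+1
  end.

Fixpoint eval_fun f xs y1 y2 {struct f} :
  eval f xs y1 -> eval f xs y2 -> y1 = y2.
Proof.
case: f => [||i|g hs|g h|g] /=.
- by move=> -> ->.
- by case: xs => [|x []] // -> ->.
- by move=> [_ ->] [_ ->].
- move=> [zs1 [E1 G1]] [zs2 [E2 G2]].
  suff E : zs1 = zs2 by rewrite -E in G2; exact: (eval_fun _ _ _ _ G1 G2).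
  elim: hs zs1 zs2 E1 E2 {G1 G2} => [|h hs IH] [|z1 zs1] [|z2 zs2] //.
  move=> [H1 E1] [H2 E2]; congr (_ :: _); last exact: IH E1 E2.
  exact: (eval_fun _ _ _ _ H1 H2).
- case: xs => // n xs [v [v0 vS ->]] [w [w0 wS ->]].
  suff E : forall i, i <= n -> v i = w i by exact: E.
  elim=> [_|i IH lt_in]; first exact: (eval_fun _ _ _ _ v0 w0).
  have := wS i lt_in; rewrite -IH ?(ltnW lt_in) // => Hw.
  exact: (eval_fun _ _ _ _ (vS i lt_in) Hw).
- move=> [Z1 L1] [Z2 L2]; case: (ltngtP y1 y2) => // lt12.
  + by case: (L2 _ lt12) => z Hz; have := eval_fun _ _ _ _ Z1 Hz.
  + by case: (L1 _ lt12) => z Hz; have := eval_fun _ _ _ _ Z2 Hz.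
Qed.

(* Decidability of a problem [P] whose instances are presented to the decision
   procedure through the encoding [enc]. *)
Definition recursively_decidable (T : Type) (enc : T -> seq nat)
    (P : T -> Prop) : Prop :=
  exists f : recfun, forall x : T,
    (P x -> eval f (enc x) 1) /\ (~ P x -> eval f (enc x) 0).

(* Finite functions on ['I_n] are encoded by their lists of values; [pickle] on
   [seq T] is MathComp's explicit Goedel numbering [CodeSeq.code], and on
   ['I_n] and [bool] it is the coercion to [nat]. *)
Definition encode1 (n : nat) (T : countType) (f : 'I_n -> T) : nat :=
  pickle (codom f).

Definition encode2 (n m : nat) (T : countType) (f : 'I_n -> 'I_m -> T) : nat :=
  pickle (codom (fun i => codom (f i))).

Definition encode3 (n m p : nat) (T : countType)
    (f : 'I_n -> 'I_m -> 'I_p -> T) : nat :=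
  pickle (codom (fun i => codom (fun j => codom (f i j)))).

(* Finite alphabets are, up to renaming of letters, the types ['I_n]. *)
Definition language (n : nat) : Type := seq 'I_n -> Prop.

Record dfa (n : nat) : Type := Dfa {
  dfa_size : nat;
  dfa_init : 'I_dfa_size;
  dfa_step : 'I_dfa_size -> 'I_n -> 'I_dfa_size;
  dfa_final : 'I_dfa_size -> bool
}.

Definition dfa_accepts (n : nat) (A : dfa n) (w : seq 'I_n) : bool :=
  dfa_final (foldl (@dfa_step n A) (dfa_init A) w).

Definition encode_dfa (n : nat) (A : dfa n) : seq nat :=
  [:: dfa_size A; pickle (dfa_init A); encode2 (@dfa_step n A);
      encode1 (@dfa_final n A)].

(* The homomorphism from ['I_n]* to ['I_m]* extending [h]. *)
Definition hom_ext (n m : nat) (h : 'I_n -> seq 'I_m) (w : seq 'I_n) :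
    seq 'I_m :=
  flatten [seq h a | a <- w].

(* [rep C n] is the type of representations in the class of languages over
   ['I_n]; its [countType] structure carries the (arbitrary) coding of
   representations as finite objects. *)
Record language_class : Type := LanguageClass {
  rep : nat -> countType;
  lang : forall n : nat, rep n -> language n
}.

Definition effectively_closed_regular_inter (C : language_class) : Prop :=
  exists f : recfun, forall (n : nat) (r : rep C n) (A : dfa n),
    exists r' : rep C n,
      eval f ([:: n; pickle r] ++ encode_dfa A) (pickle r') /\
      forall w : seq 'I_n, lang r' w <-> lang r w /\ dfa_accepts A w.

Definition effectively_closed_hom (C : language_class) : Prop :=
  exists f : recfun, forall (n m : nat) (r : rep C n) (h : 'I_n -> seq 'I_m),
    exists r' : rep C m,
      eval f [:: n; m; pickle r; encode1 h] (pickle r') /\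
      forall u : seq 'I_m,
        lang r' u <-> exists w : seq 'I_n, lang r w /\ hom_ext h w = u.

Definition effectively_closed_inverse_hom (C : language_class) : Prop :=
  exists f : recfun, forall (n m : nat) (r : rep C n) (h : 'I_m -> seq 'I_n),
    exists r' : rep C m,
      eval f [:: n; m; pickle r; encode1 h] (pickle r') /\
      forall u : seq 'I_m, lang r' u <-> lang r (hom_ext h u).

Definition full_trio (C : language_class) : Prop :=
  [/\ effectively_closed_regular_inter C,
      effectively_closed_hom C
    & effectively_closed_inverse_hom C].

Definition multiset (n : nat) : Type := {ffun 'I_n -> nat}.

Definition madd (n : nat) (m1 m2 : multiset n) : multiset n :=
  [ffun s => m1 s + m2 s].

Definition msingle (n : nat) (s : 'I_n) : multiset n :=
  [ffun t => nat_of_bool (t == s)].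

Definition parikh (n : nat) (w : seq 'I_n) : multiset n :=
  [ffun s => count_mem s w].

Record async_program (C : language_class) : Type := AsyncProgram {
  num_states : nat;
  num_handlers : nat;
  handler : 'I_num_states -> 'I_num_handlers -> 'I_num_states ->
    rep C num_handlers;
  init_state : 'I_num_states;
  init_bag : multiset num_handlers
}.

Definition encode_program (C : language_class) (P : async_program C) :
    seq nat :=
  [:: num_states P; num_handlers P; encode3 (@handler C P);
      pickle (init_state P); encode1 (init_bag P)].

Definition config (C : language_class) (P : async_program C) : Type :=
  ('I_(num_states P) * multiset (num_handlers P))%type.

Definition init_config (C : language_class) (P : async_program C) : config P :=
  (init_state P, init_bag P).

Definition transition (C : language_class) (P : async_program C)
    (c : config P) (s : 'I_(num_handlers P)) (c' : config P) : Prop :=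
  exists (m : multiset (num_handlers P)) (w : seq 'I_(num_handlers P)),
    [/\ c.2 = madd m (msingle s),
        lang (handler c.1 s c'.1) w
      & c'.2 = madd m (parikh w)].

(* A run visits [c 0], ..., [c l] if [len = Some l], and all [c i] if
   [len = None]; the values of [c] beyond position [l] are irrelevant. *)
Definition on_run (len : option nat) (i : nat) : bool :=
  if len is Some l then i <= l else true.

Definition is_run (C : language_class) (P : async_program C)
    (len : option nat) (c : nat -> config P) : Prop :=
  c 0 = init_config P /\
  forall i : nat, on_run len i.+1 ->
    exists s : 'I_(num_handlers P), transition (c i) s (c i.+1).

Definition reachable (C : language_class) (P : async_program C)
    (x : config P) : Prop :=
  exists (len : option nat) (c : nat -> config P) (i : nat),
    [/\ is_run len c, on_run len i & c i = x].

Definition terminating (C : language_class) (P : async_program C) : Prop :=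
  forall (len : option nat) (c : nat -> config P),
    is_run len c -> exists l : nat, len = Some l.

Definition safety_decidable (C : language_class) : Prop :=
  recursively_decidable
    (fun x : {P : async_program C & 'I_(num_states P)} =>
       encode_program (projT1 x) ++ [:: pickle (projT2 x)])
    (fun x => exists m : multiset (num_handlers (projT1 x)),
       reachable (projT2 x, m)).

Definition termination_decidable (C : language_class) : Prop :=
  recursively_decidable (@encode_program C) (@terminating C).

Definition emptiness_decidable (C : language_class) : Prop :=
  recursively_decidable
    (fun x : {n : nat & rep C n} => [:: projT1 x; pickle (projT2 x)])
    (fun x => forall w : seq 'I_(projT1 x), ~ lang (projT2 x) w).

(* Main.v *)
(* Emptiness reduces to both problems: erasing all letters and taking an inverse
   image under an erasing homomorphism turns L into the empty or the full unary
   language, which then decides whether a one-handler program can move at all.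

   Conversely, let emptiness be decidable.  Fix a threshold K and identify all
   numbers >= K in bags; the set of bags posted by a handler, seen through this
   abstraction, is computable from emptiness, because "the capped Parikh image
   of w is z" is a regular condition on w.  Both answers to both problems then
   have finite certificates that can be checked, so that exhaustive search
   decides.

   - An unsafe or diverging program has a concrete finite run that reaches d_f,
     respectively covers one of its own configurations (Dickson's lemma).
   - For a safe program, the configurations from which d_f is reachable form an
     upward closed set, which is determined by capped configurations when K is
     large.  Its complement is an inductive invariant of the finite abstract
     transition graph.
   - For a terminating program, the same holds for the set of configurations
     that have an infinite run.  The certificate contains moreover, for each set
     F of abstract edges, a proof that no infinite run uses exactly the edges of
     F infinitely often: F is disconnected, or there is a linear ranking function
     lam . bag + pi(node) with lam vanishing on letters that some edge of F posts
     at least K times.  If there is none, Farkas' lemma provides a circulation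
     with support F and nonnegative effect, Euler's theorem turns it into a closed
     walk, and pumping the capped letters turns the closed walk into a
     self-covering run, so that a configuration outside the invariant diverges. *)

Require Import Defs.
From mathcomp Require Import all_boot all_order all_algebra zify ring.
From mathcomp.classical Require Import boolp.

Set Implicit Arguments.
Unset Strict Implicit.
Unset Printing Implicit Defensive.

(** * Computable functions of structured arguments *)

(** Encodings have a fixed length, so that each component of an argument is reached by a fixed
    projection. *)
Record ctx : Type := Ctx {
  ctx_type :> Type;
  ctx_enc : ctx_type -> seq nat;
  ctx_arity : nat;
  ctx_encP : forall t, size (ctx_enc t) = ctx_arity
}.

Lemma ext_encP (G : ctx) (p : G * nat) :
  size (p.2 :: ctx_enc p.1) = (ctx_arity G).+1.
Proof. by rewrite /= ctx_encP. Qed.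

(** The new variable comes first: this is the position of the recursion argument in [Rec] and of the
    search variable in [Mu]. *)
Definition ext (G : ctx) : ctx :=
  @Ctx (G * nat)%type (fun p => p.2 :: ctx_enc p.1) _ (@ext_encP G).

Definition restrict (G : ctx) (P : G -> bool) : ctx :=
  @Ctx {t : G | P t} (fun t => ctx_enc (val t)) _ (fun t => ctx_encP (val t)).

Definition computable (G : ctx) (F : G -> nat) : Prop :=
  exists f, forall t, eval f (ctx_enc t) (F t).

Definition computableb (G : ctx) (P : G -> bool) : Prop := computable (fun t => P t
  : nat).

(** A named copy of the local fixpoint in the [Comp] clause of [eval]. *)
Fixpoint evals (xs : seq nat) (hs : seq recfun) (zs : seq nat) : Prop :=
  match hs, zs with
  | [::], [::] => True
  | h :: hs', z :: zs' => eval h xs z /\ evals xs hs' zs'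
  | _, _ => False
  end.

Lemma eval_Comp g hs xs zs y : evals xs hs zs -> eval g zs y ->
  eval (Comp g hs) xs y.
Proof.
move=> ev eg; exists zs; split=> //.
by elim: hs zs ev {eg} => [|h hs IH] [|z zs] //= [H /IH].
Qed.

Definition computablev (G : ctx) (F : G -> seq nat) : Prop :=
  exists fs, forall t, evals (ctx_enc t) fs (F t).

Definition computablem (G H : ctx) (phi : G -> H) : Prop :=
  computablev (fun t => ctx_enc (phi t)).

Lemma computable_ext (G : ctx) (F F' : G -> nat) :
  (forall t, F t = F' t) -> computable F -> computable F'.
Proof. by move=> E [f Hf]; exists f => t; rewrite -E. Qed.

Lemma computableb_ext (G : ctx) (P P' : G -> bool) :
  (forall t, P t = P' t) -> computableb P -> computableb P'.
Proof. by move=> E; apply: computable_ext => t; rewrite E. Qed.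

Lemma computablev_nil (G : ctx) : computablev (fun _ : G => [::]).
Proof. by exists [::]. Qed.

Lemma computablev_cons (G : ctx) (F : G -> nat) (V : G -> seq nat) :
  computable F -> computablev V -> computablev (fun t => F t :: V t).
Proof. by move=> [f Hf] [fs Hfs]; exists (f :: fs) => t; split. Qed.

Lemma computablev_drop k (G H : ctx) (phi : G -> H) :
  (forall t, drop k (ctx_enc t) = ctx_enc (phi t)) -> computablem phi.
Proof.
move=> E; exists [seq Proj i | i <- iota k (ctx_arity H)] => t.
rewrite -E; have := ctx_encP (phi t); rewrite -E.
elim: (ctx_arity H) k {E} => [|n IH] k; first by move/size0nil=> ->.
case: (ltnP k (size (ctx_enc t))) => [lt_k|le_k]; last by rewrite drop_oversize.
by rewrite (drop_nth 0 lt_k) => -[/IH Hn]; split.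
Qed.

Lemma computablem_id (G : ctx) : computablem (fun t : G => t).
Proof. by apply: (@computablev_drop 0) => t; rewrite drop0. Qed.

Lemma computablem_fst (G H : ctx) (phi : G -> H) :
  computablem phi -> computablem (fun p : ext G => phi p.1).
Proof.
move=> [fs Hfs]; have [ps Hps] : computablem (fun p : ext G => p.1).
  by apply: (@computablev_drop 1) => p; rewrite /= drop0.
exists [seq Comp f ps | f <- fs] => p.
move: (Hfs p.1) => {Hfs}.
elim: fs (ctx_enc (phi p.1)) => [|f fs IH] [|z zs] //= [H1 H2].
by split; [exact: eval_Comp (Hps p) H1 | exact: IH].
Qed.

Lemma computablem_pair (G H : ctx) (phi : G -> H) (F : G -> nat) :
  computablem phi -> computable F -> computablem (fun t => (phi t, F t) : ext H).
Proof. by move=> Hp HF; exact: computablev_cons. Qed.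

Lemma computable_subst (G H : ctx) (phi : G -> H) (F : H -> nat) :
  computable F -> computablem phi -> computable (fun t => F (phi t)).
Proof.
move=> [f Hf] [fs Hfs]; exists (Comp f fs) => t.
exact: eval_Comp (Hfs t) (Hf _).
Qed.

Lemma computable_wk (G : ctx) (F : G -> nat) :
  computable F -> computable (fun p : ext G => F p.1).
Proof.
move=> HF; exact: (@computable_subst (ext G) G (fun p => p.1) F HF
  (computablem_fst (computablem_id G))).
Qed.

Lemma computable_var (G : ctx) : computable (fun p : ext G => p.2).
Proof. by exists (Proj 0). Qed.

Lemma computable_succ (G : ctx) (F : G -> nat) :
  computable F -> computable (fun t => (F t).+1).
Proof. by move=> [f Hf]; exists (Comp Succ [:: f]) => t; exists [:: F t]. Qed.

Lemma computable_const (G : ctx) n : computable (fun _ : G => n).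
Proof. by elim: n => [|n IH]; [exists Zero | exact: computable_succ]. Qed.

Lemma computable_rec (G : ctx) (F F' : G -> nat) (H : G -> nat -> nat -> nat) :
  computable F -> computable F' -> computable (fun p : ext (ext G) => H p.1.1 p.2
    p.1.2) ->
  computable (fun t => nat_rect (fun=> nat) (F t) (fun i a => H t i a) (F' t)).
Proof.
move=> [f Hf] [f' Hf'] [h Hh]; have [ps Hps] := computablem_id G.
exists (Comp (Rec f h) (f' :: ps)) => t.
apply: (@eval_Comp _ _ _ (F' t :: ctx_enc t)); first by split.
exists (fun n => nat_rect (fun=> nat) (F t) (fun i a => H t i a) n).
by split=> // i _; exact: (Hh ((t, _), i)).
Qed.

(* [Rec] evaluates [F] only when [P] holds: this is how a partial function that
   is defined on valid arguments only gets called. *)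
Lemma computable_guard (G : ctx) (P : G -> bool) (F : G -> nat) :
  computableb P -> computable (fun t : restrict P => F (val t)) ->
  computable (fun t => if P t then F t else 0).
Proof.
move=> [p Hp] [f Hf]; have [ps Hps] := computablem_id G.
have [qs Hqs] : computablem (fun t : ext (ext G) => t.1.1).
  exact: computablem_fst (computablem_fst (computablem_id G)).
exists (Comp (Rec Zero (Comp f qs)) (p :: ps)) => t.
apply: (@eval_Comp _ _ _ ((P t : nat) :: ctx_enc t)); first by split.
exists (fun i => if i is 0 then 0 else F t); split=> // [i|]; last by case: (P t).
case Pt: (P t) => //; rewrite ltnS leqn0 => /eqP ->.
apply: eval_Comp (Hqs ((t, 0), 0)) _; exact: (Hf (exist _ t Pt)).
Qed.

Lemma computableb_guard (G : ctx) (P Q : G -> bool) :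
  computableb P -> computableb (fun t : restrict P => Q (val t)) ->
  computableb (fun t => P t && Q t).
Proof.
move=> HP HQ; apply: computable_ext (computable_guard (F := fun t => Q t : nat) HP
  HQ) => t.
by case: (P t).
Qed.

Lemma computablev_val (G : ctx) (P : G -> bool) (V : G -> seq nat) :
  computablev V -> computablev (fun t : restrict P => V (val t)).
Proof. by move=> [fs Hfs]; exists fs => t; exact: Hfs. Qed.

(* The second premise, checked by conversion, says that [F] ignores the last
   variable. *)
Lemma computable_leaf (G : ctx) (F : ext G -> nat) :
  computable (fun t => F (t, 0)) -> (forall p, F p = F (p.1, 0)) -> computable F.
Proof. by move=> /computable_wk HF E; apply: computable_ext HF => p; rewrite
  [RHS]E. Qed.

Lemma computablem_leaf (G H : ctx) (phi : ext G -> H) :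
  computablem (fun t => phi (t, 0)) -> (forall p, phi p = phi (p.1, 0)) ->
    computablem phi.
Proof.
move=> /computablem_fst [fs Hfs] E; exists fs => p; rewrite E; exact: Hfs.
Qed.

(** * Arithmetic and bounded quantification *)

Lemma computable_add (G : ctx) (F F' : G -> nat) :
  computable F -> computable F' -> computable (fun t => F t + F' t).
Proof.
move=> HF HF'; apply: computable_ext (computable_rec (H := fun t i a => a.+1) HF
  HF' _).
  by move=> t; elim: (F' t) => [|n /= ->]; rewrite ?addn0 ?addnS.
exact/computable_succ/computable_wk/computable_var.
Qed.

Lemma computable_pred (G : ctx) (F : G -> nat) :
  computable F -> computable (fun t => (F t).-1).
Proof.
move=> HF; apply: computable_ext (computable_rec (H := fun t i a => i)
  (computable_const _ 0) HF _).
  by move=> t; case: (F t).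
exact: computable_var.
Qed.

Lemma computable_sub (G : ctx) (F F' : G -> nat) :
  computable F -> computable F' -> computable (fun t => F t - F' t).
Proof.
move=> HF HF'; apply: computable_ext (computable_rec (H := fun t i a => a.-1) HF
  HF' _).
  by move=> t; elim: (F' t) => [|n /= ->]; rewrite ?subn0 ?subnS.
exact/computable_pred/computable_wk/computable_var.
Qed.


Ltac computability_leaves := repeat (cbn [fst snd];
  first [ assumption | refine (computable_var _) | (refine (@computable_leaf _ _ _
    _); [ | by move=> ?]) ]).

Definition bA (n : nat) (P : nat -> bool) : bool := all P (iota 0 n).
Definition bE (n : nat) (P : nat -> bool) : bool := has P (iota 0 n).

Definition bS (n : nat) (F : nat -> nat) : nat := \sum_(i < n) F i.

Lemma bAP n (P : nat -> bool) : reflect (forall i, i < n -> P i) (bA n P).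
Proof.
apply: (iffP allP) => H i; first by move=> lt_in; apply: H; rewrite mem_iota.
by rewrite mem_iota => /H.
Qed.

Lemma bEP n (P : nat -> bool) : reflect (exists2 i, i < n & P i) (bE n P).
Proof.
apply: (iffP hasP) => -[i Hi Pi]; exists i => //; move: Hi; by rewrite mem_iota.
Qed.

Lemma computable_mul (G : ctx) (F F' : G -> nat) :
  computable F -> computable F' -> computable (fun t => F t * F' t).
Proof.
move=> HF HF'.
apply: computable_ext (computable_rec (H := fun t i a => a + F t) (computable_const
  _ 0) HF' _).
  by move=> t; elim: (F' t) => [|n /= ->]; rewrite ?muln0 // mulnS addnC.
by apply: computable_add; computability_leaves.
Qed.

Lemma computable_exp (G : ctx) (F F' : G -> nat) :
  computable F -> computable F' -> computable (fun t => F t ^ F' t).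
Proof.
move=> HF HF'.
apply: computable_ext (computable_rec (H := fun t i a => a * F t) (computable_const
  _ 1) HF' _).
  by move=> t; elim: (F' t) => [|n /= ->]; rewrite ?expn0 // expnSr.
by apply: computable_mul; computability_leaves.
Qed.

Lemma computableb_not (G : ctx) (P : G -> bool) :
  computableb P -> computableb (fun t => ~~ P t).
Proof.
move=> HP; apply: computable_ext (computable_sub (computable_const G 1) HP) => t.
by case: (P t).
Qed.

Lemma computableb_and (G : ctx) (P Q : G -> bool) :
  computableb P -> computableb Q -> computableb (fun t => P t && Q t).
Proof.
by move=> HP HQ; apply: computable_ext (computable_mul HP HQ) => t; rewrite mulnb.
Qed.

Lemma computableb_or (G : ctx) (P Q : G -> bool) :
  computableb P -> computableb Q -> computableb (fun t => P t || Q t).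
Proof.
move=> /computableb_not HP /computableb_not HQ.
by apply: computableb_ext (computableb_not (computableb_and HP HQ)) => t; rewrite
  negb_and !negbK.
Qed.

Lemma computableb_implb (G : ctx) (P Q : G -> bool) :
  computableb P -> computableb Q -> computableb (fun t => P t ==> Q t).
Proof.
move=> /computableb_not HP HQ.
by apply: computableb_ext (computableb_or HP HQ) => t; rewrite implybE.
Qed.

Lemma computableb_leq (G : ctx) (F F' : G -> nat) :
  computable F -> computable F' -> computableb (fun t => F t <= F' t).
Proof.
move=> HF HF'; apply: computable_ext (computable_sub (computable_const G 1)
  (computable_sub HF HF')) => t.
by rewrite /leq; case: (F t - F' t).
Qed.

Lemma computableb_eqn (G : ctx) (F F' : G -> nat) :
  computable F -> computable F' -> computableb (fun t => F t == F' t).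
Proof.
move=> HF HF'.
apply: computableb_ext (computableb_and (computableb_leq HF HF') (computableb_leq
  HF' HF)) => t.
by rewrite eqn_leq.
Qed.

Lemma computable_if (G : ctx) (P : G -> bool) (F F' : G -> nat) :
  computableb P -> computable F -> computable F' -> computable (fun t => if P t
    then F t else F' t).
Proof.
move=> HP HF HF'.
apply: computable_ext (computable_add (computable_mul HP HF) (computable_mul
  (computableb_not HP) HF')) => t.
by case: (P t); rewrite ?mul1n ?mul0n ?addn0.
Qed.

Lemma computable_minn (G : ctx) (F F' : G -> nat) :
  computable F -> computable F' -> computable (fun t => minn (F t) (F' t)).
Proof.
by move=> HF HF'; apply: computable_if => //; apply: computableb_leq => //; apply:
  computable_succ.
Qed.

Lemma computable_sum (G : ctx) (F : G -> nat) (H : G -> nat -> nat) :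
  computable F -> computable (fun p : ext G => H p.1 p.2) ->
  computable (fun t => bS (F t) (H t)).
Proof.
move=> HF HH.
apply: computable_ext (computable_rec (H := fun t i a => a + H t i)
  (computable_const _ 0) HF _).
  by rewrite /bS => t; elim: (F t) => [|n /= ->]; rewrite ?big_ord0 ?big_ord_recr.
apply: computable_add; first by computability_leaves.
apply: (@computable_subst (ext (ext G)) (ext G) (fun p => (p.1.1, p.2)) _ HH).
exact: computablem_pair (computablem_fst (computablem_fst (computablem_id G)))
  (computable_var _).
Qed.

Lemma computableb_bE (G : ctx) (F : G -> nat) (P : G -> nat -> bool) :
  computable F -> computableb (fun p : ext G => P p.1 p.2) ->
  computableb (fun t => bE (F t) (P t)).
Proof.
move=> HF HP; have HS := computable_sum (H := fun t i => P t i : nat) HF HP.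
apply: computableb_ext (computableb_not (computableb_eqn HS (computable_const _
  0))) => t /=.
rewrite /bS sum_nat_eq0 negb_forall; apply/existsP/bEP => [[i /= Hi]|[i lt_in Pi]].
  by exists i => //; case: (P t i) Hi.
by exists (Ordinal lt_in); rewrite /= Pi.
Qed.

Lemma computableb_bA (G : ctx) (F : G -> nat) (P : G -> nat -> bool) :
  computable F -> computableb (fun p : ext G => P p.1 p.2) ->
  computableb (fun t => bA (F t) (P t)).
Proof.
move=> HF /computableb_not HP.
apply: computableb_ext (computableb_not (computableb_bE (P := fun t i => ~~ P t i)
  HF HP)) => t.
by rewrite /bA /bE -all_predC; apply: eq_all => i /=; rewrite negbK.
Qed.

(** An extension point, rebound when further primitives have been proved computable. *)
Ltac computability_hook := fail.

Ltac computability_step := cbv beta; cbn [fst snd];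
  lazymatch goal with
  | |- computableb (fun t => ~~ @?P t) => refine (@computableb_not _ P _)
  | |- computableb (fun t => @?P t && @?Q t) => refine (@computableb_and _ P Q _ _)
  | |- computableb (fun t => @?P t || @?Q t) => refine (@computableb_or _ P Q _ _)
  | |- computableb (fun t => @?P t ==> @?Q t) => refine (@computableb_implb _ P Q _
    _)
  | |- computableb (fun t => @?F t <= @?H t) => refine (@computableb_leq _ F H _ _)
  | |- computableb (fun t => @eq_op _ (@?F t) (@?H t)) =>
      refine (@computableb_eqn _ F H _ _)
  | |- computableb (fun t => bA (@?F t) (@?P t)) => refine (@computableb_bA _ F P _
    _)
  | |- computableb (fun t => bE (@?F t) (@?P t)) => refine (@computableb_bE _ F P _
    _)
  | |- computable (fun t => nat_of_bool (@?P t)) => change (computableb P)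
  | |- computable (fun _ => ?c) => refine (computable_const _ c)
  | |- computable (fun t => S (@?F t)) => refine (@computable_succ _ F _)
  | |- computable (fun t => @?F t + @?H t) => refine (@computable_add _ F H _ _)
  | |- computable (fun t => @?F t - @?H t) => refine (@computable_sub _ F H _ _)
  | |- computable (fun t => @?F t * @?H t) => refine (@computable_mul _ F H _ _)
  | |- computable (fun t => @?F t ^ @?H t) => refine (@computable_exp _ F H _ _)
  | |- computable (fun t => minn (@?F t) (@?H t)) => refine (@computable_minn _ F H
    _ _)
  | |- computable (fun t => if _ then _ else _) => refine (@computable_if _ _ _ _ _
    _ _)
  | |- computable (fun t => bS (@?F t) (@?H t)) => refine (@computable_sum _ F H _
    _)
  | |- _ => first [ computability_hook | assumption | refine (computable_var _)
                  | (refine (@computable_leaf _ _ _ _); [ | by move=> ?])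
                  | refine (computablem_id _)
                  | (refine (@computablem_leaf _ _ _ _ _); [ | by move=> ?]) ]
  end.
Ltac computability := repeat computability_step.

(** For [d > 0], the quotient [m %/ d] counts the positive multiples of [d] up to [m], which is a
    bounded sum. *)
Lemma computable_div (G : ctx) (F F' : G -> nat) :
  computable F -> computable F' -> computable (fun t => F t %/ F' t).
Proof.
move=> HF HF'; apply: (@computable_ext _ (fun t => if F' t == 0 then 0 else
    bS (F t) (fun i => i.+1 * F' t <= F t))); last by computability.
move=> t; case: eqP => [->|/eqP]; first by rewrite divn0.
rewrite -lt0n; move: (F t) (F' t) => m d d0; rewrite /bS.
have E : \sum_(i < m) (i.+1 * d <= m) = \sum_(i < m) (i < m %/ d : nat).
  by apply: eq_bigr => i _; rewrite leq_divRL.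
rewrite E -(big_mkord xpredT (fun i => i < m %/ d : nat)).
rewrite (big_cat_nat (leq0n (m %/ d))) ?leq_div //=.
rewrite [X in _ + X = _]big_nat_cond [X in _ + X = _]big1 ?addn0; last first.
  by move=> i /andP[/andP[le_i _] _]; rewrite ltnNge le_i.
rewrite big_nat_cond (eq_bigr (fun=> 1)) => [|i /andP[/andP[_ ->]]] //.
by rewrite -big_nat_cond sum_nat_const_nat muln1 subn0.
Qed.

Lemma computable_mod (G : ctx) (F F' : G -> nat) :
  computable F -> computable F' -> computable (fun t => F t %% F' t).
Proof.
move=> HF HF'; apply: computable_ext (computable_sub HF (computable_mul
  (computable_div HF HF') HF')) => t.
by rewrite {1}(divn_eq (F t) (F' t)) addKn.
Qed.

(** * Goedel codes of lists, and digits *)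

(** [CodeSeq.code] sends [n :: s] to [2 ^ n * (2 * c + 1)], where [c] codes [s]. So the head is the
    exponent of 2, and division removes it together with the marker bit. The empty list has code 0,
    on which both functions return 0, in accordance with the default of [nth 0]. *)
Definition hdc (c : nat) : nat := logn 2 c.
Definition tlc (c : nat) : nat := c %/ 2 ^ (hdc c).+1.
Definition nthc (c i : nat) : nat := hdc (iter i tlc c).

Lemma hdc_cons n c : hdc (2 ^ n * c.*2.+1) = n.
Proof.
rewrite /hdc lognM ?expn_gt0 // pfactorK // (@lognE 2 c.*2.+1) dvdn2 /=.
by rewrite odd_double addn0.
Qed.

Lemma tlc_cons n c : tlc (2 ^ n * c.*2.+1) = c.
Proof.
rewrite /tlc hdc_cons expnSr divnMl ?expn_gt0 // -addn1 -muln2 divnMDl //.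
by rewrite divn_small ?addn0.
Qed.

Lemma nthc_code s i : nthc (CodeSeq.code s) i = nth 0 s i.
Proof.
have E0 j : iter j tlc 0 = 0 by elim: j => //= j ->; rewrite /tlc div0n.
rewrite /nthc; elim: i s => [|i IH] [|n s]; rewrite ?E0 //; first exact: hdc_cons.
by rewrite iterSr /= tlc_cons IH.
Qed.

(** The exponent of 2 in [c] is the number of [k] with [0 < k < c] such that [2 ^ k] divides [c]. *)
Lemma computable_hdc (G : ctx) (F : G -> nat) :
  computable F -> computable (fun t => hdc (F t)).
Proof.
move=> HF; apply: (@computable_ext _ (fun t => bS (F t).-1 (fun i =>
   F t %% 2 ^ i.+1 == 0))); last first.
  have HP := computable_pred HF.
  apply: (@computable_sum _ (fun t => (F t).-1) (fun t i => F t %% 2 ^ i.+1 == 0))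
    => //.
  apply: computableb_eqn; last exact: computable_const.
  by apply: computable_mod; computability.
move=> t; rewrite /hdc /bS logn_count_dvd // big_add1 big_mkord.
by apply: eq_bigr.
Qed.

Lemma computable_tlc (G : ctx) (F : G -> nat) :
  computable F -> computable (fun t => tlc (F t)).
Proof.
move=> HF; apply: computable_div => //; apply: computable_exp; first exact:
  computable_const.
exact/computable_succ/computable_hdc.
Qed.

Lemma computable_nthc (G : ctx) (F F' : G -> nat) :
  computable F -> computable F' -> computable (fun t => nthc (F t) (F' t)).
Proof.
move=> HF HF'; apply: computable_hdc.
apply: computable_ext (computable_rec (H := fun t i a => tlc a) HF HF' _) => [t|].
  by elim: (F' t) => //= n ->.
by apply: computable_tlc; computability.
Qed.

Lemma computable_code (G : ctx) (F : G -> nat) (H : G -> nat -> nat) :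
  computable F -> computable (fun p : ext G => H p.1 p.2) ->
  computable (fun t => CodeSeq.code (mkseq (H t) (F t))).
Proof.
move=> HF HH.
(* Each recursion step prepends, so the list is built from its end: step [i] adds the entry at index
   [F t - i.+1]. *)
pose step t i a := 2 ^ H t (F t - i.+1) * a.*2.+1.
apply: computable_ext (computable_rec (H := step) (computable_const _ 0) HF _) =>
  [t|].
  suff E m : m <= F t -> nat_rect (fun=> nat) 0 (step t) m =
      CodeSeq.code (map (H t) (iota (F t - m) m)) by rewrite E // subnn.
  elim: m => //= m IH lt_m; rewrite IH ?(ltnW lt_m) // /step.
  by rewrite subnSK.
rewrite /step.
have HS : computable (fun p : ext (ext G) => F p.1.1 - p.2.+1) by computability.
apply: computable_mul.
  apply: computable_exp; first exact: computable_const.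
  apply: (@computable_subst (ext (ext G)) (ext G) (fun p => (p.1.1, _)) _ HH).
  exact: computablem_pair (computablem_fst (computablem_fst (computablem_id G))) HS.
apply: computable_succ; apply: (@computable_ext (ext (ext G)) (fun p => p.1.2 * 2)).
  by move=> p; rewrite muln2.
by computability.
Qed.

(** Finite functions with values below [b] are stored as the digits of one number in base [b];
    quantifiers over such functions thereby become quantifiers over numbers. *)
Definition dig (b s x : nat) : nat := x %/ b ^ s %% b.
Definition num (b k : nat) (f : nat -> nat) : nat := bS k (fun s => f s * b ^ s).

Lemma num_lt b k f : (forall s, s < k -> f s < b) -> num b k f < b ^ k.
Proof.
rewrite /num /bS; elim: k => [|k IH] H; first by rewrite big_ord0.
rewrite big_ord_recr /= expnS.
have := IH (fun s Hs => H s (ltnW Hs)); have := H k (ltnSn k).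
case: b H {IH} => // b _; rewrite !ltnS => Hk Hn; rewrite mulSn.
rewrite -addSn leq_add // leq_mul2r Hk orbT //.
Qed.

Lemma dig_num b k f j : (forall s, s < k -> f s < b) -> j < k ->
  dig b j (num b k f) = f j.
Proof.
rewrite /num /bS => H; elim: k H => // k IH H; rewrite ltnS leq_eqVlt.
have b0 : 0 < b by exact: leq_ltn_trans (H k (ltnSn k)).
have Hk : forall s, s < k -> f s < b by move=> s /ltnW/H.
rewrite big_ord_recr /= /dig => /predU1P[->|lt_jk].
  rewrite divnDMl ?expn_gt0 ?b0 // divn_small ?add0n ?modn_small ?H //.
  exact: num_lt.
rewrite -[in RHS](IH Hk lt_jk) /dig -(subnK lt_jk) addnS -addSn expnD mulnA.
by rewrite divnDMl ?expn_gt0 ?b0 // expnSr mulnA addnC modnMDl.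
Qed.

Lemma computable_dig (G : ctx) (b s x : G -> nat) :
  computable b -> computable s -> computable x -> computable (fun t => dig (b t) (s
    t) (x t)).
Proof.
move=> Hb Hs Hx; apply: computable_mod => //; apply: computable_div => //; exact:
  computable_exp.
Qed.

Ltac computability_hook ::=
  lazymatch goal with
  | |- computable (fun t => dig (@?b t) (@?s t) (@?x t)) =>
      refine (@computable_dig _ b s x _ _ _)
  | |- computable (fun t => CodeSeq.code (mkseq (@?H t) (@?F t))) =>
      refine (@computable_code _ F H _ _)
  | |- computable (fun t => num (@?b t) (@?k t) (@?f t)) => rewrite /num
  end.

(** * Search *)

(** One of the two answers always has a certificate, so minimization terminates at the least number
    that certifies either. Evaluating [yes] there gives the answer, by soundness. *)
Lemma decidable_by_search (G : ctx) (Pr : G -> Prop) (yes no : G -> nat -> bool) :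
  computableb (fun p : ext G => yes p.1 p.2) -> computableb (fun p : ext G => no
    p.1 p.2) ->
  (forall x, Pr x -> exists y, yes x y) -> (forall x, ~ Pr x -> exists y, no x y) ->
  (forall x y, yes x y -> Pr x) -> (forall x y, no x y -> ~ Pr x) ->
  recursively_decidable (@ctx_enc G) Pr.
Proof.
move=> Hyes Hno exY exN soundY soundN.
have [fy Hfy] := Hyes.
have [fn Hfn] := computableb_not (computableb_or Hyes Hno).
have [ps Hps] := computablem_id G.
have ex x : exists y, yes x y || no x y.
  by case: (pselect (Pr x)) => [/exY|/exN] [y E]; exists y; rewrite E ?orbT.
exists (Comp fy (Mu fn :: ps)) => x.
case: (ex_minnP (ex x)) => y Hy min_y.
have E : eval (Comp fy (Mu fn :: ps)) (ctx_enc x) (yes x y).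
  apply: (@eval_Comp _ _ _ (y :: ctx_enc x)); last exact: (Hfy (x, y)).
  split=> //; split; first by have := Hfn (x, y); rewrite /= Hy.
  move=> i lt_iy; exists 0; have := Hfn (x, i); rewrite /=.
  by case: (boolP (yes x i || no x i)) => // /min_y; rewrite leqNgt lt_iy.
split=> Px; move: E Hy; case Yy: (yes x y) => //.
  by move=> _ /soundN.
by have := soundY _ _ Yy.
Qed.

(** * Dickson's lemma *)

Definition mle (n : nat) (m m' : multiset n) : Prop := forall s, m s <= m' s.

(** From every position [N] on there is an index where [f] attains its minimum over the tail;
    iterating this choice gives the subsequence. *)
Lemma nondecreasing_subsequence (f : nat -> nat) :
  exists2 phi : nat -> nat, {homo phi : i j / i < j} &
    {homo f \o phi : i j / i <= j}.
Proof.
have /choice[g Hg] N : exists k, N <= k /\ forall j, N <= j -> f k <= f j.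
  have ex : exists y, `[< exists2 k, N <= k & f k = y >].
    by exists (f N); apply/asboolP; exists N.
  case: (ex_minnP ex) => _ /asboolP[k le_k <-] min_k.
  by exists k; split=> // j le_j; apply: min_k; apply/asboolP; exists j.
pose phi := fix phi i := if i is i'.+1 then g (phi i').+1 else g 0.
have phiS i : phi i < phi i.+1 by case: (Hg (phi i).+1).
have mono : {homo phi : i j / i < j} by apply: homo_ltn phiS; exact: ltn_trans.
exists phi => // i j; rewrite leq_eqVlt => /predU1P[-> //|lt_ij] /=.
suff H k : phi i <= k -> f (phi i) <= f k by apply/H/ltnW/mono.
by case: i {lt_ij} => [|i] /= Hk; apply: (Hg _).2 => //;
   apply: leq_trans Hk; exact: leq_trans (Hg _).1.
Qed.

Lemma dickson_subsequence n (f : nat -> multiset n) :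
  exists2 phi : nat -> nat, {homo phi : i j / i < j} &
    forall i j, i <= j -> mle (f (phi i)) (f (phi j)).
Proof.
suff [phi mono H] : exists2 phi : nat -> nat, {homo phi : i j / i < j} &
    forall s, s \in enum 'I_n -> {homo (fun i => f (phi i) s) : i j / i <= j}.
  by exists phi => // i j le_ij s; apply: H => //; rewrite mem_enum.
elim: (enum 'I_n) => [|s l [phi mono H]]; first by exists id.
have [psi mono' H'] := nondecreasing_subsequence (fun i => f (phi i) s).
exists (phi \o psi) => [i j /mono'/mono //|t].
rewrite inE => /predU1P[->|/H Ht] i j le_ij; first exact: (H' i j).
apply: Ht; move: le_ij; rewrite leq_eqVlt => /predU1P[-> //|/mono'/ltnW //].
Qed.

Definition mcap (n : nat) (K : nat) (m : multiset n) : multiset n :=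
  [ffun s => minn K (m s)].

(* [K0] bounds the entries of the (finitely many) minimal elements of [U]. *)
Lemma upward_closed_cap n (U : multiset n -> Prop) :
  (forall m m', mle m m' -> U m -> U m') ->
  exists K0, forall K m, K0 <= K -> U m -> U (mcap K m).
Proof.
move=> up; apply: contrapT => noK.
have /choice[f Hf] K : exists m, U m /\ ~ U (mcap K m).
  apply: contrapT => H; apply: noK; exists K => K' m le_K Um.
  apply: contrapT => nU; apply: H; exists m; split=> // U'; apply: nU.
  by apply: up U' => s; rewrite !ffunE; move: le_K; rewrite !minnE; lia.
(* [f K] is a bag in [U] whose cap at [K] is outside [U]. The thresholds [phi i] exceed or equal all
   entries of the earlier bags [f (phi j)]. Dickson's lemma then puts an earlier bag below a later
   one, and even below its cap, which is therefore in [U]. *)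
pose phi := fix phi i := if i is i'.+1 then \max_s f (phi i') s + phi i' else 0.
have phiS i j : i < j -> forall s, f (phi i) s <= phi j.
  elim: j => // j IH; rewrite ltnS leq_eqVlt => /predU1P[->|/IH H] s /=.
    by rewrite (leq_trans (leq_bigmax s)) ?leq_addr.
  by rewrite (leq_trans (H s)) ?leq_addl.
have [psi mono H] := dickson_subsequence (fun i => f (phi i)).
have := (Hf (phi (psi 1))).2; apply; apply: up (Hf (phi (psi 0))).1 => s.
rewrite ffunE leq_min (H 0 1) // andbT; apply: phiS; exact: mono.
Qed.

(** * Farkas' lemma over the integers *)

Section Farkas.
Import Order.TTheory GRing.Theory Num.Theory.
Local Open Scope ring_scope.
Variables (J : eqType) (I : finType).

Definition dot (l v : I -> int) : int := \sum_i l i * v i.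

Lemma dot_lin l v w (a b : int) :
  dot l (fun i => a * v i - b * w i) = a * dot l v - b * dot l w.
Proof.
rewrite /dot !mulr_sumr -sumrB; apply: eq_bigr => i _; ring.
Qed.

Lemma dot_linl l m v (a b : int) :
  dot (fun i => a * l i - b * m i) v = a * dot l v - b * dot m v.
Proof.
rewrite /dot !mulr_sumr -sumrB; apply: eq_bigr => i _; ring.
Qed.

(** Induction on the generators. If the functional [l] found without [v] is positive at [v], all
    vectors are projected along [v] into the kernel of [l] and the induction hypothesis is applied
    again. The multiplier [a] of [u] takes the place of division. *)
Lemma farkas (s : seq J) (A : J -> I -> int) (u : I -> int) : uniq s ->
  (exists a c, [/\ 0 < a, forall j, 0 <= c j
     & forall i, a * u i + \sum_(j <- s) c j * A j i = 0]) \/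
  (exists l, (forall j, j \in s -> dot l (A j) <= 0) /\ dot l u < 0).
Proof.
elim: s A u => [|v s IH] A u /=.
  move=> _; have [u0|/existsNP[i ui]] := pselect (forall i, u i = 0).
    left; exists 1, (fun=> 0); split=> // i.
    by rewrite big_nil u0 mulr0 addr0.
  right; exists (fun i => - u i); split=> //.
  rewrite /dot (bigD1 i) //= ltr_wnDr // ?sumr_le0 // => [j _|];
    nia.
move=> /andP[vs us].
case: (IH A u us) => [[a [c [a0 c0 E]]]|[l [Hs Hu]]].
  left; exists a, (fun j => if j == v then 0 else c j); split=> // [j|i].
    by case: ifP.
  rewrite big_cons eqxx mul0r add0r -[RHS](E i); congr (_ + _).
  apply: eq_big_seq => j js; case: eqP => // Ej.
  by rewrite -Ej js in vs.
case: (lerP (dot l (A v)) 0) => [Hv|Hv].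
  by right; exists l; split=> // j; rewrite inE => /predU1P[->|/Hs].
set k := dot l (A v) in Hv.
pose red w i := k * w i - dot l w * A v i.
case: (IH (fun j => red (A j)) (red u) us) => [[a [c [a0 c0 E]]]|[m [Hm Hu']]].
  left; exists (a * k).
  (* The coefficient of [v] comes from expanding the projections [red]. It is nonnegative because
     [l] is negative at [u] and nonpositive at the other generators. *)
  exists (fun j => if j == v then - (a * dot l u + \sum_(j <- s) c j * dot l (A j))
     else k * c j).
  split; first by rewrite mulr_gt0.
    move=> j; case: ifP => _; last by rewrite mulr_ge0 // ltW.
    have H1 : a * dot l u <= 0 by rewrite mulr_ge0_le0 // ltW.
    have H2 : \sum_(j <- s) c j * dot l (A j) <= 0.
      by rewrite big_seq sumr_le0 // => i /Hs; exact: mulr_ge0_le0.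
    by rewrite oppr_ge0 -[X in _ <= X]addr0 lerD.
  move=> i; rewrite big_cons eqxx.
  have -> : \sum_(j <- s)
      (if j == v then - (a * dot l u + \sum_(j <- s) c j * dot l (A j))
       else k * c j) * A j i = \sum_(j <- s) k * c j * A j i.
    apply: eq_big_seq => j js; case: eqP => // Ej.
    by rewrite -Ej js in vs.
  rewrite -[RHS](E i) /red.
  have -> : \sum_(j <- s) c j * (k * A j i - dot l (A j) * A v i) =
      \sum_(j <- s) k * c j * A j i - (\sum_(j <- s) c j * dot l (A j)) * A v i.
    rewrite mulr_suml -sumrB; apply: eq_bigr => j _; ring.
  ring.
(* This functional is [m] composed with the projection [red], so it vanishes at [v]. *)
right; exists (fun i => k * m i - dot m (A v) * l i).
have E w : dot (fun i => k * m i - dot m (A v) * l i) w = dot m (red w).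
  by rewrite dot_linl dot_lin mulrC; ring.
split=> [j|]; last by rewrite E.
rewrite inE E => /predU1P[->|/Hm //].
by rewrite dot_lin -/k mulrC subrr.
Qed.

End Farkas.

(** * Eulerian closed walks *)

Section Euler.
Variables (E N : eqType) (src dst : E -> N).

Fixpoint walk (x : N) (p : seq E) (y : N) : bool :=
  if p is e :: p' then (src e == x) && walk (dst e) p' y else x == y.

Lemma walk_cat x p q y :
  walk x (p ++ q) y = walk x p (last x (map dst p)) && walk (last x (map dst p)) q
    y.
Proof. by elim: p x => [|e p IH] x /=; rewrite ?eqxx // IH andbA. Qed.

Lemma walk_last x p y : walk x p y -> y = last x (map dst p).
Proof. by elim: p x => [|e p IH] x /=; [move/eqP | case/andP=> _ /IH]. Qed.

Definition balanced (l : seq E) : Prop :=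
  forall v, count (fun e => src e == v) l = count (fun e => dst e == v) l.

Lemma walk_count x p y v : walk x p y ->
  count (fun e => src e == v) p + (y == v) = count (fun e => dst e == v) p + (x ==
    v).
Proof.
elim: p x => [|e p IH] x /=; first by move/eqP->.
by case/andP=> /eqP <- /IH; lia.
Qed.

Lemma closed_balanced x p : walk x p x -> balanced p.
Proof. by move=> Hp v; have := walk_count v Hp; lia. Qed.

Lemma balanced_perm l l' : perm_eq l l' -> balanced l -> balanced l'.
Proof. by move=> /permP H B v; rewrite -!H. Qed.

Lemma balanced_catr p r : balanced p -> balanced (p ++ r) -> balanced r.
Proof. by move=> Bp B v; have := B v; have := Bp v; rewrite !count_cat; lia. Qed.

Lemma closed_subwalk l e : balanced l -> e \in l ->
  exists c r, [/\ walk (src e) c (src e), c != [::] & perm_eq (c ++ r) l].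
Proof.
move=> Bl el; pose final c := last (src e) (map dst c).
have exit c r : walk (src e) c (final c) -> perm_eq (c ++ r) l ->
    final c != src e -> exists2 f, f \in r & src f = final c.
  move=> Wc; rewrite perm_sym => /balanced_perm/(_ Bl (final c)) Bcr ne.
  suff /hasP[f fr /eqP Ef] : has (fun f => src f == final c) r by exists f.
  have := walk_count (final c) Wc; move: Bcr.
  by rewrite !count_cat has_count eqxx eq_sym (negPf ne); lia.
suff H k c r : size r <= k -> c != [::] -> walk (src e) c (final c) ->
    perm_eq (c ++ r) l -> exists c r,
    [/\ walk (src e) c (src e), c != [::] & perm_eq (c ++ r) l].
  apply: (H (size (rem e l)) [:: e] (rem e l)); rewrite //= ?eqxx //.
  by rewrite perm_sym perm_to_rem.
elim: k c r => [|k IH] c r le_r c0 Wc Pc;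
  have [Ec|/(exit _ _ Wc Pc)[f fr Ef]] := eqVneq (final c) (src e).
- by exists c, r; split; rewrite // -{2}Ec.
- by move: le_r fr; rewrite leqn0 => /nilP ->.
- by exists c, r; split; rewrite // -{2}Ec.
apply: (IH (rcons c f) (rem f r)).
- by rewrite size_rem //; move: le_r; case: (r) fr.
- by case: (c).
- by rewrite /final map_rcons last_rcons -cats1 walk_cat -/(final c) Wc /= Ef !eqxx.
- by rewrite cat_rcons (perm_trans _ Pc) // perm_cat2l perm_sym perm_to_rem.
Qed.

Lemma rot_closed x p e : walk x p x -> e \in p ->
  exists2 q, walk (src e) q (src e) & perm_eq q p.
Proof.
move=> Hp /splitPr Ep; case: Ep Hp => p1 p2; rewrite walk_cat /= => /and3P[H1 /eqP
  E2 H2].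
exists (e :: p2 ++ p1); last by rewrite -cat_cons perm_catC.
by rewrite /= eqxx walk_cat -(walk_last H2) H2 E2.
Qed.

Lemma euler (l : seq E) : l != [::] -> balanced l ->
  (forall chi : N -> bool, (forall e, e \in l -> chi (src e) = chi (dst e)) ->
     forall e e', e \in l -> e' \in l -> chi (src e) = chi (src e')) ->
  exists x p, perm_eq p l /\ walk x p x.
Proof.
move=> l0 Bl conn.
suff H k p r x : size r <= k -> p != [::] -> walk x p x -> perm_eq (p ++ r) l ->
    exists x p, perm_eq p l /\ walk x p x.
  case: l l0 Bl {conn} H => // e l _ Bl H.
  have [c [r [Wc c0 Pc]]] := closed_subwalk Bl (mem_head e l).
  exact: (H (size r) c r (src e)).
elim: k p r x => [|k IH] p r x le_r p0 Wp Pp.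
  move: le_r Pp; rewrite leqn0 => /nilP ->; rewrite cats0 => Pp.
  by exists x, p.
have [r0|r0] := eqVneq r [::]; first by exists x, p; split=> //; rewrite r0 cats0
  in Pp.
have memE e : (e \in l) = (e \in p) || (e \in r) by rewrite -(perm_mem Pp) mem_cat.
have Bp := closed_balanced Wp.
have Br : balanced r.
  by apply: balanced_catr Bp _; apply: balanced_perm Bl; rewrite perm_sym.
pose chi v := has (fun e => src e == v) p.
have dstP v : has (fun e => dst e == v) p = chi v by rewrite /chi !has_count Bp.
have srcR v : has (fun e => dst e == v) r = has (fun e => src e == v) r.
  by rewrite !has_count Br.
have chip e : e \in p -> chi (src e) by move=> ep; apply/hasP; exists e.
have chipd e : e \in p -> chi (dst e) by rewrite -dstP => ep; apply/hasP; exists e.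
(* By connectivity: otherwise [chi], the set of nodes on [p], would be respected by all edges and
   yet separate [p] from [r]. *)
have [e er] : exists2 e, e \in r & chi (src e).
  apply: contrapT => H.
  have Hs e : e \in r -> chi (src e) = false.
    by move=> er; apply/negP => ce; apply: H; exists e.
  have Hd e : e \in r -> chi (dst e) = false.
    move=> er; have : has (fun f => dst f == dst e) r by apply/hasP; exists e.
    by rewrite srcR => /hasP[f fr /eqP <-]; exact: Hs.
  have [e0 e0p] : exists e, e \in p by case: (p) p0 => // e ? _; exists e; exact:
    mem_head.
  have [e1 e1r] : exists e, e \in r by case: (r) r0 => // e ? _; exists e; exact:
    mem_head.
  have chiE e : e \in l -> chi (src e) = chi (dst e).
    by rewrite memE => /orP[ep|er]; [rewrite chip ?chipd | rewrite Hs ?Hd].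
  have := conn chi chiE e0 e1; rewrite !memE e0p e1r orbT chip // Hs //.
  by move=> /(_ isT isT).
case/hasP => f fp /eqP Ef.
have [q Wq Pq] := rot_closed Wp fp.
have [c [r' [Wc c0 Pc]]] := closed_subwalk Br er.
apply: (IH (q ++ c) r' (src f)).
- move/perm_size: Pc le_r; rewrite size_cat; case: c c0 {Wc} => //= *; lia.
- by case: q Pq {Wq} => // /perm_size/esym/size0nil E0; rewrite E0 in p0.
- by rewrite walk_cat -(walk_last Wq) Wq Ef Wc.
rewrite -catA (perm_trans _ Pp) //; exact: perm_cat.
Qed.
End Euler.

(** * Capped configurations *)

(** Bags are extended by 0 to all numbers, because the certificate checks handle letters as
    numbers. *)
Definition fnat (n : nat) (m : multiset n) (t : nat) : nat := nth 0 (codom m) t.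

Lemma fnatE n (m : multiset n) (t : 'I_n) : fnat m t = m t.
Proof.
by rewrite /fnat (nth_map t) ?size_enum_ord // nth_ord_enum.
Qed.

(** Bags capped at [K] correspond to the numbers below [K.+1 ^ n], with multiplicities as digits in
    base [K.+1]; [capcode] is the converse direction. *)
Definition vec (K n x : nat) : multiset n := [ffun t : 'I_n => dig K.+1 t x].

Definition capcode (K n : nat) (f : nat -> nat) : nat :=
  num K.+1 n (fun t => minn K (f t)).

Lemma dig_capcode K n f t : t < n -> dig K.+1 t (capcode K n f) = minn K (f t).
Proof. by apply: dig_num => s _; rewrite ltnS geq_minl. Qed.

Lemma vec_capcode K n (m : multiset n) : vec K n (capcode K n (fnat m)) = mcap K m.
Proof. by apply/ffunP => t; rewrite !ffunE dig_capcode // fnatE. Qed.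

Lemma capcode_lt K n f : capcode K n f < K.+1 ^ n.
Proof. by apply: num_lt => s _; rewrite ltnS geq_minl. Qed.

Lemma dig_le K t x : dig K.+1 t x <= K.
Proof. by rewrite -ltnS ltn_mod. Qed.

(* A digit [K] of [x], [y] or [z] stands for any number [>= K]. *)
Definition compat (K n x s z y : nat) : bool :=
  bA n (fun t => ((t == s) <= dig K.+1 t x) &&
    ((dig K.+1 t y == minn K (dig K.+1 t x - (t == s) + dig K.+1 t z)) ||
     ((dig K.+1 t x == K) && (dig K.+1 t y == K)))).

(** The concrete counterpart of [compat]: digits of [x] and [y] are literal multiplicities, and
    digits of [z] below [K] cannot result from capping. *)
Definition exact (K n x s z y : nat) : bool :=
  bA n (fun t => ((t == s) <= dig K.+1 t x) && (dig K.+1 t z < K) &&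
    (dig K.+1 t y == dig K.+1 t x - (t == s) + dig K.+1 t z)).

(** [O d s d' z] stands for: in context [(d, s, d')] some bag with capped code [z] can be posted. *)
Definition invcheck (K nD n : nat) (O : nat -> nat -> nat -> nat -> bool)
    (d0 x0 : nat) (I : nat -> nat -> bool) : bool :=
  I d0 x0 &&
  bA nD (fun d => bA n (fun s => bA nD (fun d' => bA (K.+1 ^ n) (fun x =>
    bA (K.+1 ^ n) (fun z => bA (K.+1 ^ n) (fun y =>
      I d x && compat K n x s z y && O d s d' z ==> I d' y)))))).

Definition pathcheck (K n : nat) (O : nat -> nat -> nat -> nat -> bool)
    (d0 : nat) (m0 : nat -> nat) (l : nat) (D X : nat -> nat) : bool :=
  (D 0 == d0) && bA n (fun t => dig K.+1 t (X 0) == m0 t) &&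
  bA l (fun i => bE n (fun s => bE (K.+1 ^ n) (fun z =>
    exact K n (X i) s z (X i.+1) && O (D i) s (D i.+1) z))).

(** * Monotone transition systems on bags *)

Section System.
Variables (nD n : nat).
Variable Post : 'I_nD -> 'I_n -> 'I_nD -> multiset n -> Prop.

Notation conf := ('I_nD * multiset n)%type.
Implicit Types (c : conf) (m v : multiset n).

Definition fires c (s : 'I_n) v c' : Prop :=
  [/\ Post c.1 s c'.1 v, 0 < c.2 s & forall t, c'.2 t + (t == s) = c.2 t + v t].

Definition step c c' : Prop := exists s v, fires c s v c'.

Definition cle c c' : Prop := c.1 = c'.1 /\ mle c.2 c'.2.


Lemma cle_refl c : cle c c.
Proof. by split=> // s; exact: leqnn. Qed.

Lemma cle_trans c1 c2 c3 : cle c1 c2 -> cle c2 c3 -> cle c1 c3.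
Proof.
by move=> [E1 H1] [E2 H2]; split=> [|t]; rewrite ?E1 //; exact: leq_trans (H1 t)
  (H2 t).
Qed.

Definition fire m (s : 'I_n) v : multiset n := [ffun t => m t - (t == s) + v t].

Lemma fireP d s d' v m : Post d s d' v -> 0 < m s -> fires (d, m) s v (d', fire m s
  v).
Proof.
by move=> HP ms; split=> // t; rewrite /= ffunE; case: eqP => [->|_] /=; lia.
Qed.

Lemma fires_mono c1 s v c2 c : fires c1 s v c2 -> cle c1 c ->
  exists2 c', fires c s v c' & cle c2 c'.
Proof.
case: c1 c2 c => [d1 m1] [d2 m2] [d m] [/= HP m1s E] [/= <- le_m].
exists (d2, fire m s v); first by apply: fireP => //; exact: leq_trans (le_m s).
split=> // t; rewrite ffunE; have := E t; have := le_m t.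
by case: eqP => [->|_] /=; lia.
Qed.

Lemma step_mono c1 c2 c : step c1 c2 -> cle c1 c -> exists2 c', step c c' & cle c2
  c'.
Proof.
move=> [s [v H]] /(fires_mono H)[c' H' le_c]; exists c' => //; by exists s, v.
Qed.

Inductive eventually (Q : conf -> Prop) : conf -> Prop :=
| Ev_now c : Q c -> eventually Q c
| Ev_step c c' : step c c' -> eventually Q c' -> eventually Q c.

Definition diverges c : Prop :=
  exists g : nat -> conf, g 0 = c /\ forall i, step (g i) (g i.+1).

Definition upward (U : conf -> Prop) : Prop :=
  forall c c', cle c c' -> U c -> U c'.

Definition backward (U : conf -> Prop) : Prop :=
  forall c c', step c c' -> U c' -> U c.

Lemma eventually_upward Q : upward Q -> upward (eventually Q).
Proof.
move=> up c c' le_c Hc; elim: Hc c' le_c => [{}c Qc|c1 c2 s12 _ IH] c' le_c.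
  by apply: Ev_now; exact: up Qc.
have [c3 s3 le3] := step_mono s12 le_c.
by apply: Ev_step s3 _; exact: IH.
Qed.

Lemma eventually_path Q c : eventually Q c ->
  exists l (g : nat -> conf), [/\ g 0 = c, forall i, i < l -> step (g i) (g i.+1) &
    Q (g l)].
Proof.
elim=> [{}c Qc|c1 c2 s12 _ [l [g [g0 gS gl]]]]; first by exists 0, (fun=> c).
exists l.+1, (fun i => if i is i'.+1 then g i' else c1); split=> // -[|i] /=.
  by rewrite g0.
exact: gS.
Qed.

Lemma path_eventually Q (g : nat -> conf) l :
  (forall i, i < l -> step (g i) (g i.+1)) -> Q (g l) -> eventually Q (g 0).
Proof.
move=> gS gl; suff H i : i <= l -> eventually Q (g (l - i)).
  by rewrite -(subnn l); exact: H.
elim: i => [|i IH] le_il; first by rewrite subn0; exact: Ev_now.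
apply: (@Ev_step _ _ (g (l - i))); last by apply: IH; exact: ltnW.
by rewrite -(subnSK le_il); apply: gS; lia.
Qed.

Lemma diverges_coind (S : conf -> Prop) c :
  (forall c, S c -> exists2 c', step c c' & S c') -> S c -> diverges c.
Proof.
move=> HS Sc.
have /choice[f Hf] (x : {x | S x}) : exists y : {y | S y}, step (sval x) (sval y).
  by case: x => x Sx; have [y sxy Sy] := HS x Sx; exists (exist _ y Sy).
pose g i := iter i f (exist _ c Sc).
by exists (fun i => sval (g i)); split=> // i; exact: Hf.
Qed.

Lemma diverges_upward : upward diverges.
Proof.
move=> c c' le_c Dc.
apply: (@diverges_coind (fun x => exists2 y, cle y x & diverges y)); last by exists
  c.
move=> x [y le_yx [g [g0 gS]]]; have := gS 0; rewrite g0 => s1.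
have [x' sx le_x'] := step_mono s1 le_yx; exists x' => //; exists (g 1) => //.
by exists (fun i => g i.+1).
Qed.

Lemma diverges_backward : backward diverges.
Proof.
move=> c c' s [g [g0 gS]]; exists (fun i => if i is i'.+1 then g i' else c).
by split=> // -[|i]; rewrite ?g0.
Qed.

(** By monotonicity the covering run can be repeated from any larger configuration. The coinduction
    invariant says that the current configuration lies above one from which the rest of a round is
    still possible. *)
Lemma self_covering_diverges c c1 :
  step c c1 -> eventually (cle c) c1 -> diverges c.
Proof.
move=> s1 E1.
apply: (@diverges_coind (fun x => exists y y1, [/\ cle y x, step y y1 &
  eventually (cle c) y1])); last first.
  by exists c, c1; split=> //; exact: cle_refl.
move=> x [y [y1 [le_yx sy Ey]]]; have [x' sx le_x'] := step_mono sy le_yx.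
exists x' => //; case: Ey le_x' {sy} => [z le_c le_x'|z y2 s12 E2 le_x'].
  by exists c, c1; split=> //; exact: cle_trans le_x'.
by exists z, y2.
Qed.

(** Along a subsequence with nondecreasing bags, two of the first [nD.+1] states coincide. *)
Lemma diverges_self_covering (g : nat -> conf) : (forall i, step (g i) (g i.+1)) ->
  exists i j, i < j /\ cle (g i) (g j).
Proof.
move=> gS; have [phi mono H] := dickson_subsequence (fun i => (g i).2).
pose d (i : 'I_nD.+1) := (g (phi i)).1.
have /injectivePn[i [j neq_ij Eij]] : ~~ injectiveb d.
  by apply/injectiveP => /leq_card; rewrite !card_ord ltnn.
wlog lt_ij : i j neq_ij Eij / i < j.
  move=> W; move: (neq_ij); rewrite neq_ltn => /orP[|lt_ij]; first exact: W.
  by apply: (W j i) => //; rewrite eq_sym.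
exists (phi i), (phi j); split; first exact: mono.
by split=> //; apply: H; exact: ltnW.
Qed.

(** * Capped invariants and coded paths *)

Section Check.
Variables (K : nat) (O : nat -> nat -> nat -> nat -> bool).
Hypothesis K0 : 0 < K.
Hypothesis OP : forall d s d' z, O d s d' z <->
  exists (d0 : 'I_nD) (s0 : 'I_n) (d0' : 'I_nD) v,
    [/\ [/\ d = d0, s = s0 & d' = d0'], Post d0 s0 d0' v & z = capcode K n (fnat
      v)].

Definition bagcode m : nat := capcode K n (fnat m).

Lemma dig_bagcode m (t : 'I_n) : dig K.+1 t (bagcode m) = minn K (m t).
Proof. by rewrite dig_capcode // fnatE. Qed.

Lemma compat_fires c s v c' : fires c s v c' -> compat K n (bagcode c.2) s (bagcode
  v) (bagcode c'.2).
Proof.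
move=> [_ ms E]; apply/bAP => t lt_t.
rewrite -[t]/(nat_of_ord (Ordinal lt_t)); move: (Ordinal lt_t) => {lt_t}t.
rewrite !dig_bagcode; have := E t; rewrite -[t == s :> nat]/(t == s).
case: eqP ms => [-> | _ _] /=; rewrite !minnE; lia.
Qed.

Lemma O_fires c s v c' : fires c s v c' -> O c.1 s c'.1 (bagcode v).
Proof. by move=> [HP _ _]; apply/OP; exists c.1, s, c'.1, v. Qed.

Lemma inv_step I d0 x0 c s v c' : invcheck K nD n O d0 x0 I ->
  fires c s v c' -> I c.1 (bagcode c.2) -> I c'.1 (bagcode c'.2).
Proof.
move=> /andP[_ H] Hf Ic.
move/bAP: H => /(_ _ (ltn_ord c.1))/bAP/(_ _ (ltn_ord s))/bAP/(_ _ (ltn_ord c'.1)).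
move=> /bAP/(_ (bagcode c.2) (capcode_lt _ _ _))/bAP/(_ (bagcode v) (capcode_lt _ _
  _)).
move=> /bAP/(_ (bagcode c'.2) (capcode_lt _ _ _)).
by rewrite Ic (compat_fires Hf) (O_fires Hf).
Qed.

(** Each digit [K] of [x] is realized by the multiplicity [K.+1], so that at least [K] copies remain
    when one is consumed. *)
Lemma compat_lift d d' (s : 'I_n) v x y z :
  compat K n x s z y -> Post d s d' v -> z = bagcode v ->
  exists m m', [/\ mcap K m = vec K n x, fires (d, m) s v (d', m') &
    mle (vec K n y) m'].
Proof.
move=> /bAP Hc HP Ez.
pose m : multiset n := [ffun t : 'I_n => dig K.+1 t x + (dig K.+1 t x == K)].
have ms : 0 < m s.
  by have /andP[] := Hc s (ltn_ord s); rewrite eqxx ffunE; lia.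
exists m, (fire m s v); split; last 1 first.
- move=> t; have := Hc t (ltn_ord t); rewrite /fire !ffunE Ez dig_bagcode.
  by rewrite -[t == s :> nat]/(t == s); rewrite !minnE; lia.
- apply/ffunP => t; rewrite !ffunE minnE; have := dig_le K t x.
  by case: eqP; lia.
exact: fireP.
Qed.

(** An abstract edge into [U] lifts to a concrete step into [U] whose source has the capped bag of
    the edge's source. Closure under predecessors and stability under capping then put the source of
    the edge into [U]. *)
Lemma inv_complete (U : conf -> Prop) (I : nat -> nat -> bool) c0 : upward U ->
  backward U ->
  (forall d m, U (d, m) -> U (d, mcap K m)) ->
  (forall (d : 'I_nD) x, x < K.+1 ^ n -> I d x = `[< ~ U (d, vec K n x) >]) ->
  ~ U c0 -> invcheck K nD n O c0.1 (bagcode c0.2) I.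
Proof.
move=> up back stab IP nU; apply/andP; split.
  rewrite IP ?capcode_lt //; apply/asboolP; rewrite vec_capcode => U0.
  apply: nU; apply: up U0; split=> // t; rewrite ffunE; exact: geq_minr.
apply/bAP => d lt_d; apply/bAP => s lt_s; apply/bAP => d' lt_d'.
apply/bAP => x lt_x; apply/bAP => z lt_z; apply/bAP => y lt_y.
apply/implyP => /andP[/andP[Ix Hc] /OP].
move=> [e [s0 [e' [v [[Ed Es Ed'] HP Ez]]]]].
move: Ix Hc; rewrite Ed Es Ed' !IP // => /asboolP nUx Hc; apply/asboolP => Uy.
have [m [m' [Em Hf le_y]]] := compat_lift Hc HP Ez.
apply: nUx; rewrite -Em; apply: stab; apply: (back _ (e', m')).
  by exists s0, v.
by apply: up Uy; split.
Qed.

Lemma exactP (s : 'I_n) v x y : 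
  reflect ([/\ 0 < vec K n x s, forall t, v t < K &
     forall t, vec K n y t + (t == s) = vec K n x t + v t])
  (exact K n x s (bagcode v) y).
Proof.
apply: (iffP (bAP _ _)) => [H|[Hs Hv E] t lt_t].
  have H' (t : 'I_n) := H t (ltn_ord t); split=> [|t|t].
  - by have := H' s; rewrite ffunE eqxx -andbA => /andP[].
  - by have := H' t; rewrite dig_bagcode minnE; lia.
  have := H' t; rewrite dig_bagcode !ffunE minnE -[t == s :> nat]/(t == s); lia.
rewrite -[t]/(nat_of_ord (Ordinal lt_t)); move: (Ordinal lt_t) => {lt_t}t.
have := E t; have := Hv t; move: Hs; rewrite dig_bagcode !ffunE minnE.
by rewrite -[t == s :> nat]/(t == s); case: eqP => [->|]; lia.
Qed.

Lemma path_sound c0 l D X : pathcheck K n O c0.1 (fnat c0.2) l D X ->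
  exists g : nat -> conf, [/\ g 0 = c0, forall i, i < l -> step (g i) (g i.+1) &
    forall i, i <= l -> (g i).1 = D i :> nat /\ (g i).2 = vec K n (X i)].
Proof.
move=> /andP[/andP[/eqP D0 /bAP X0] /bAP H].
pose g i : conf := (insubd c0.1 (D i), vec K n (X i)).
have HD i : i <= l -> D i < nD.
  case: i => [|i lt_i]; first by rewrite D0.
  have /bEP[s lt_s /bEP[z lt_z /andP[_ /OP]]] := H i lt_i.
  by move=> [e [s0 [e' [v [[_ _ ->] _ _]]]]].
have gD i : i <= l -> (g i).1 = D i :> nat.
  by move=> /HD lt_D; rewrite /= /insubd insubT.
exists g; split=> [|i lt_i|i le_i]; last by split; first exact: gD.
  case: c0 D0 X0 @g {HD gD} => d0 m0 /= D0 X0; congr (_, _).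
    by apply: val_inj; rewrite /= D0 /insubd valK.
  by apply/ffunP => t; rewrite ffunE (eqP (X0 t (ltn_ord t))) fnatE.
have /bEP[s _ /bEP[z _ /andP[He /OP]]] := H i lt_i.
move=> [e [s0 [e' [v [[Ee Es Ee'] HP Ez]]]]]; exists s0, v.
have -> : g i = (e, vec K n (X i)).
  by congr (_, _); apply: val_inj; rewrite /= -Ee gD // ltnW.
have -> : g i.+1 = (e', vec K n (X i.+1)).
  by congr (_, _); apply: val_inj; rewrite /= -Ee' gD.
by move: He; rewrite Es Ez => /exactP[].
Qed.

Lemma path_complete (g : nat -> conf) l :
  (forall i, i <= l -> forall t, (g i).2 t <= K) ->
  (forall i, i < l -> exists s v, fires (g i) s v (g i.+1) /\ forall t, v t < K) ->
  pathcheck K n O (g 0).1 (fnat (g 0).2) l (fun i => (g i).1) (fun i => bagcode (g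
    i).2).
Proof.
move=> gK gS.
have vecE i : i <= l -> vec K n (bagcode (g i).2) = (g i).2.
  by move=> /gK Hi; apply/ffunP => t; rewrite ffunE dig_bagcode; apply/minn_idPr.
rewrite /pathcheck eqxx /=; apply/andP; split; apply/bAP => i lt_i.
  rewrite -[i]/(nat_of_ord (Ordinal lt_i)) dig_bagcode fnatE.
  by apply/eqP/minn_idPr; exact: gK.
have [s [v [Hf vK]]] := gS i lt_i.
apply/bEP; exists s => //; apply/bEP; exists (bagcode v); first exact: capcode_lt.
rewrite (O_fires Hf) andbT; apply/exactP; rewrite !vecE //; last exact: ltnW.
by case: Hf.
Qed.

End Check.
End System.

(** * Ranking functions and circulations *)

Section Circulation.
Import Order.TTheory GRing.Theory Num.Theory.
Variables (n NN : nat) (s : seq nat) (z : nat -> nat -> nat) (sg src dst : nat ->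
  nat).
Variable (Z : pred nat).
Hypothesis us : uniq s.
Hypothesis sgP : forall e, e \in s -> sg e < n.
Hypothesis srcP : forall e, e \in s -> src e < NN.
Hypothesis dstP : forall e, e \in s -> dst e < NN.

Definition decreasing (lam pi : nat -> nat) : Prop :=
  [/\ forall t, t < n -> Z t -> lam t = 0,
      forall e, e \in s ->
        bS n (fun t => lam t * z e t) + pi (dst e) <= lam (sg e) + pi (src e) &
      exists2 e, e \in s &
        bS n (fun t => lam t * z e t) + pi (dst e) < lam (sg e) + pi (src e)].

Definition circulation (f : nat -> nat) : Prop :=
  [/\ forall e, e \in s -> 0 < f e,
      forall t, t < n -> ~~ Z t ->
        \sum_(e <- s) f e * (t == sg e) <= \sum_(e <- s) f e * z e t &
      forall v, \sum_(e <- s) f e * (src e == v) = \sum_(e <- s) f e * (dst e ==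
        v)].

Local Open Scope ring_scope.

(** Column [inl e] is the effect of the edge [e], on the letters outside [Z] and on the nodes.
    Column [inr t] is a slack: dually it forces the weight of [t] to be nonnegative. *)
Let A (j : nat + 'I_n) (i : 'I_n + 'I_NN) : int :=
  match j, i with
  | inl e, inl t =>
      if Z t then 0 else (z e t)%:Z - (nat_of_bool (t == sg e :> nat))%:Z
  | inl e, inr v =>
      (nat_of_bool (dst e == v))%:Z - (nat_of_bool (src e == v))%:Z
  | inr t, inl t' => - (nat_of_bool (t == t'))%:Z
  | inr _, inr _ => 0
  end.

Let cols : seq (nat + 'I_n) := [seq inl e | e <- s] ++ [seq inr t | t <- enum 'I_n].

Lemma uniq_cols : uniq cols.
Proof.
rewrite cat_uniq (map_inj_uniq (@inl_inj _ _)) (map_inj_uniq (@inr_inj _ _)).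
rewrite us enum_uniq andbT /=.
by apply/hasPn => _ /mapP[t _ ->]; apply/negP => /mapP[].
Qed.

Lemma sum_indic m (l : nat -> int) k : (k < m)%N ->
  \sum_(v < m) l v * (nat_of_bool (k == v))%:Z = l k.
Proof.
move=> lt_k; rewrite (bigD1 (Ordinal lt_k)) //= eqxx mulr1 big1 ?addr0 // => i.
by rewrite -val_eqE /= eq_sym => /negPf ->; rewrite mulr0.
Qed.

Lemma dot_edge l e : e \in s ->
  dot l (A (inl e)) =
  \sum_(t < n) l (inl t) * A (inl e) (inl t) +
  \sum_(v < NN) l (inr v) * A (inl e) (inr v).
Proof. by move=> es; rewrite /dot big_sumType. Qed.

(** The letter part of [l] gives [lam] and the node part gives [pi]. Adding the constant [C] makes
    [pi] nonnegative and cancels along each edge. *)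
Lemma dual_decreasing e0 l : e0 \in s ->
  (forall j, j \in cols -> dot l (A j) <= 0) -> dot l (A (inl e0)) < 0 ->
  exists lam pi, decreasing lam pi.
Proof.
move=> e0s Hl H0.
have l_ge0 t : 0 <= l (inl t).
  have := Hl (inr t); rewrite mem_cat orbC (mem_map (@inr_inj _ _)) mem_enum /=.
  move=> /(_ isT); rewrite /dot big_sumType /= [X in _ + X]big1 ?addr0; last first.
    by move=> *; rewrite mulr0.
  rewrite (bigD1 t) //= eqxx big1 ?addr0; first by lia.
  by move=> i; rewrite eq_sym => /negPf ->; rewrite oppr0 mulr0.
pose lam t : nat := if insub t is Some t' then if Z t then 0%N else absz (l (inl
  t')) else 0%N.
pose C : int := \sum_(v < NN) `|l (inr v)|.
pose pi v : nat := if insub v is Some v' then absz (l (inr v') + C) else 0%N.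
have lamE (t : 'I_n) : (lam t)%:Z = if Z t then 0 else l (inl t).
  by rewrite /lam valK; case: ifP => // _; rewrite gez0_abs.
have piE (v : 'I_NN) : (pi v)%:Z = l (inr v) + C.
  rewrite /pi valK gez0_abs // /C (bigD1 v) //=.
  have : 0 <= \sum_(i < NN | i != v) `|l (inr i)| by apply: sumr_ge0 => i _.
  by move: (\sum_(i < NN | i != v) _) (l (inr v)) => S a; lia.
have E e : e \in s -> (bS n (fun t => lam t * z e t)%N + pi (dst e))%:Z -
    (lam (sg e) + pi (src e))%:Z = dot l (A (inl e)).
  move=> es; rewrite dot_edge //.
  have -> : \sum_(v < NN) l (inr v) * A (inl e) (inr v) =
     (pi (dst e))%:Z - (pi (src e))%:Z.
    rewrite -(sum_indic (fun v => (pi v)%:Z) (dstP es)).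
    rewrite -(sum_indic (fun v => (pi v)%:Z) (srcP es)) -sumrB.
    have HC : \sum_(v < NN) C * A (inl e) (inr v) = 0.
      rewrite -mulr_sumr /= sumrB.
      have := sum_indic (fun=> 1) (dstP es); have := sum_indic (fun=> 1) (srcP es).
      under eq_bigr do rewrite mul1r; move=> ->.
      by under eq_bigr do rewrite mul1r; move=> ->; rewrite subrr mulr0.
    transitivity (\sum_(v < NN)
      (l (inr v) * A (inl e) (inr v) + C * A (inl e) (inr v))).
      by apply/esym; rewrite big_split /= HC; exact: addr0.
    apply: eq_bigr => v _.
    by rewrite !piE /A; ring.
  have -> : \sum_(t < n) l (inl t) * A (inl e) (inl t) =
     (bS n (fun t => lam t * z e t)%N)%:Z - (lam (sg e))%:Z.
    rewrite -(sum_indic (fun v => (lam v)%:Z) (sgP es)) /bS.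
    rewrite (big_morph Posz PoszD (erefl _)) -sumrB.
    apply: eq_bigr => t _ /=; rewrite PoszM lamE (eq_sym (sg e)).
    by case: ifP => _; ring.
  lia.
exists lam, pi; split=> [t lt_t Zt|e es|].
- by rewrite /lam insubT Zt.
- have := Hl (inl e); rewrite mem_cat (mem_map (@inl_inj _ _)) es -E //.
  by move=> /(_ isT); lia.
- by exists e0 => //; rewrite -E // in H0; lia.
Qed.

Definition weak_circulation (f : nat -> nat) : Prop :=
  (forall t, (t < n)%N -> ~~ Z t ->
     (\sum_(e <- s) f e * (t == sg e) <= \sum_(e <- s) f e * z e t)%N) /\
  (forall v, (\sum_(e <- s) f e * (src e == v) =
     \sum_(e <- s) f e * (dst e == v))%N).

(** The multiplicity of an edge is its Farkas coefficient, increased by [a] at [e0], which makes it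
    positive there; the slack columns turn the equations for letters into inequalities. *)
Lemma primal_circulation e0 a c : e0 \in s -> 0 < a -> (forall j, 0 <= c j) ->
  (forall i, a * A (inl e0) i + \sum_(j <- cols) c j * A j i = 0) ->
  exists2 f, (0 < f e0)%N & weak_circulation f.
Proof.
move=> e0s a0 c0 H.
pose f e : nat := absz (c (inl e) + (if e == e0 then a else 0)).
have fE e : (f e)%:Z = c (inl e) + (if e == e0 then a else 0).
  by rewrite /f gez0_abs // addr_ge0 //; case: ifP => // _; exact: ltW.
have E i : \sum_(e <- s) (f e)%:Z * A (inl e) i =
    - \sum_(t < n) c (inr t) * A (inr t) i.
  have := H i; rewrite /cols big_cat !big_map.
  rewrite [X in _ + (_ + X) = _](_ : _ = \sum_(t < n) c (inr t) * A (inr t) i);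
    last by rewrite -big_enum.
  have -> : \sum_(e <- s) (f e)%:Z * A (inl e) i =
      \sum_(e <- s) c (inl e) * A (inl e) i + a * A (inl e0) i.
    rewrite -[X in _ + X]addr0 (bigD1_seq e0) //= fE eqxx.
    rewrite [in RHS](bigD1_seq e0) //=.
    rewrite (eq_bigr (fun e => c (inl e) * A (inl e) i)); first by ring.
    by move=> e /negPf ne; rewrite fE ne addr0.
  by move=> Hi; apply/eqP; rewrite -subr_eq0 opprK -[X in _ == X]Hi; apply/eqP;
    ring.
exists f; first by rewrite -ltz_nat fE eqxx ltr_wpDl.
have sumZ (g h : nat -> nat) :
    (\sum_(e <- s) g e * h e)%N%:Z = \sum_(e <- s) (g e)%:Z * (h e)%:Z.
  by rewrite (big_morph Posz PoszD (erefl _)); apply: eq_bigr => e _; rewrite PoszM.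
split=> [t lt_t nZ|v].
  have := E (inl (Ordinal lt_t)).
  rewrite [X in - X](bigD1 (Ordinal lt_t)) //= eqxx [X in _ + X]big1 ?addr0; last
    first.
    by move=> t' /negPf ->; rewrite oppr0 mulr0.
  rewrite (eq_bigr (fun e => (f e)%:Z * (z e t)%:Z -
     (f e)%:Z * (nat_of_bool (t == sg e))%:Z)); last first.
    by move=> e _; rewrite (negPf nZ); ring.
  by rewrite sumrB -!sumZ; have := c0 (inr (Ordinal lt_t)); lia.
case: (ltnP v NN) => [lt_v|le_v].
  have := E (inr (Ordinal lt_v)).
  rewrite [X in - X]big1 /=; last by move=> t' _; rewrite mulr0.
  rewrite (eq_bigr (fun e => (f e)%:Z * (nat_of_bool (dst e == v))%:Z -
     (f e)%:Z * (nat_of_bool (src e == v))%:Z)); last by move=> e _; ring.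
  by rewrite sumrB -!sumZ; lia.
rewrite !big_seq !big1 // => e es.
  by move: (dstP es) => lt_d; rewrite (ltn_eqF (leq_trans lt_d le_v)) muln0.
by move: (srcP es) => lt_d; rewrite (ltn_eqF (leq_trans lt_d le_v)) muln0.
Qed.

(** For each [e0], Farkas' lemma yields a ranking function strict at [e0] or a weak circulation
    through [e0]. If there is no ranking function, the sum of these circulations is positive on
    every edge. *)
Lemma ranking_or_circulation :
  (exists lam pi, decreasing lam pi) \/ (exists f, circulation f).
Proof.
have [H|H] := pselect (exists lam pi, decreasing lam pi); [by left | right].
have /choice[G HG] e0 : exists f, e0 \in s -> (0 < f e0)%N /\ weak_circulation f.
  case: (boolP (e0 \in s)) => [e0s|_]; last by exists (fun=> 0%N).
  case: (farkas A (A (inl e0)) uniq_cols) => [[a [c [a0 c0 E]]]|[l [Hl H0]]].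
    by have [f f0 Hf] := primal_circulation e0s a0 c0 E; exists f.
  by case: H; exact: dual_decreasing e0s Hl H0.
have E h : (\sum_(e <- s) (\sum_(e0 <- s) G e0 e) * h e =
    \sum_(e0 <- s) \sum_(e <- s) G e0 e * h e)%N.
  by rewrite exchange_big; apply: eq_bigr => e _; rewrite big_distrl.
exists (fun e => \sum_(e0 <- s) G e0 e)%N; split=> [e es|t lt_t nZ|v].
- by rewrite (bigD1_seq e) //= ltn_addr // (HG e es).1.
- rewrite !E !big_seq; apply: leq_sum => e0 e0s.
  exact: (HG e0 e0s).2.1.
- by rewrite !E; apply: eq_big_seq => e0 e0s; rewrite (HG e0 e0s).2.2.
Qed.

End Circulation.

(** * Certificates of termination *)

(* An edge is a number with base-[B] digits [d, x, s, z, d', y]: an abstract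
   transition from [(d, x)] to [(d', y)] firing [s] and posting [z]. *)
Definition esrc (B e : nat) : nat := dig B 0 e + dig B 1 e * B.
Definition edst (B e : nat) : nat := dig B 4 e + dig B 5 e * B.

Definition vedge (K n : nat) (O : nat -> nat -> nat -> nat -> bool)
    (I : nat -> nat -> bool) (B e : nat) : bool :=
  (dig B 1 e < K.+1 ^ n) && (dig B 5 e < K.+1 ^ n) &&
  I (dig B 0 e) (dig B 1 e) &&
  compat K n (dig B 1 e) (dig B 2 e) (dig B 3 e) (dig B 5 e) &&
  O (dig B 0 e) (dig B 2 e) (dig B 4 e) (dig B 3 e).

(* Either [F] is disconnected, or [lam . m + pi (node)] is a ranking function
   for infinite runs that use exactly the edges of [F] infinitely often. *)
Definition rank_ok (K n B : nat) (F : nat -> bool) (lam pi chi : nat -> nat) : bool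
  :=
  (bA (B ^ 6) (fun e => F e ==>
     bA n (fun t => (dig K.+1 t (dig B 3 e) == K) ==> (lam t == 0)) &&
     (bS n (fun t => lam t * dig K.+1 t (dig B 3 e)) + pi (edst B e)
        <= lam (dig B 2 e) + pi (esrc B e))) &&
   bE (B ^ 6) (fun e => F e &&
     (bS n (fun t => lam t * dig K.+1 t (dig B 3 e)) + pi (edst B e)
        < lam (dig B 2 e) + pi (esrc B e)))) ||
  (bA (B ^ 6) (fun e => F e ==> (chi (esrc B e) == chi (edst B e))) &&
   bE (B ^ 6) (fun e => bE (B ^ 6) (fun e' =>
     F e && F e' && ~~ (chi (esrc B e) == chi (esrc B e'))))).

Section Termination.
Variables (nD n : nat).
Variable Post : 'I_nD -> 'I_n -> 'I_nD -> multiset n -> Prop.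
Variables (K : nat) (O : nat -> nat -> nat -> nat -> bool).
Hypothesis K0 : 0 < K.
Hypothesis OP : forall d s d' z, O d s d' z <->
  exists (d0 : 'I_nD) (s0 : 'I_n) (d0' : 'I_nD) v,
    [/\ [/\ d = d0, s = s0 & d' = d0'], Post d0 s0 d0' v & z = capcode K n (fnat
      v)].
Variables (B : nat) (I : nat -> nat -> bool).
Hypothesis BD : nD <= B.
Hypothesis Bn : n <= B.
Hypothesis BM : K.+1 ^ n <= B.

Notation conf := ('I_nD * multiset n)%type.
Notation bagcode := (@bagcode n K).

(** * Soundness of ranking certificates *)

Lemma no_infinite_descent (f : nat -> nat) N :
  (forall i, N <= i -> f i.+1 <= f i) ->
  (forall i, N <= i -> exists2 j, i <= j & f j.+1 < f j) -> False.
Proof.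
move=> dec inf.
have mono i j : N <= i -> i <= j -> f j <= f i.
  move=> le_i; elim: j => [|j IH]; first by rewrite leqn0 => /eqP->.
  rewrite leq_eqVlt => /predU1P[<- //|]; rewrite ltnS => le_ij.
  by apply: leq_trans (dec j _) (IH le_ij); exact: leq_trans le_ij.
have H k : exists2 i, N <= i & f i + k <= f N.
  elim: k => [|k [i le_i Hi]]; first by exists N; rewrite ?addn0.
  have [j le_ij lt_j] := inf i le_i.
  exists j.+1; first exact: leq_trans le_i (leqW le_ij).
  by have := mono i j le_i le_ij; lia.
by have [i _] := H (f N).+1; lia.
Qed.

Lemma infinitely_often E (e : nat -> nat) : (forall i, e i < E) ->
  exists F : nat -> bool, exists2 N,
    forall i, N <= i -> F (e i) & forall x i, F x -> exists2 j, i <= j & e j = x.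
Proof.
move=> eE; pose F x := `[< forall i, exists2 j, i <= j & e j = x >].
have /choice[g Hg] x : exists N, ~~ F x -> forall j, N <= j -> e j <> x.
  case: (boolP (F x)) => [_|/asboolPn/existsNP[N HN]]; first by exists 0.
  by exists N => _ j le_j Ej; apply: HN; exists j.
exists F, (\max_(x < E) g x) => [i le_i|x i /asboolP]; last exact.
apply: contrapT => /negP nF; apply: (Hg _ nF i) => //.
exact: leq_trans (leq_bigmax (Ordinal (eE i))) le_i.
Qed.

(** [F] is the set of abstract edges that the run uses infinitely often. *)
Lemma rank_sound (g : nat -> conf) :
  invcheck K nD n O (g 0).1 (bagcode (g 0).2) I ->
  (forall i, step Post (g i) (g i.+1)) ->
  exists2 F : nat -> bool, exists2 e, e < B ^ 6 & F e && vedge K n O I B e &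
    forall lam pi chi, ~~ rank_ok K n B (fun e => F e && vedge K n O I B e) lam pi
      chi.
Proof.
move=> inv /choice[s /choice[v Hf]].
have Ig i : I (g i).1 (bagcode (g i).2).
  elim: i => [|i IH]; first by case/andP: inv.
  exact: (inv_step K0 OP inv (Hf i) IH).
pose c i : seq nat := [:: val (g i).1; bagcode (g i).2; val (s i); bagcode (v i);
  val (g i.+1).1; bagcode (g i.+1).2].
have cB i j : j < 6 -> nth 0 (c i) j < B.
  have M m : bagcode m < B by exact: leq_trans (capcode_lt _ _ _) BM.
  by case: j => [|[|[|[|[|[|//]]]]]] _ /=; rewrite ?M // (leq_trans (ltn_ord _)).
pose e i := num B 6 (nth 0 (c i)).
have eE i : e i < B ^ 6 by apply: num_lt => j; exact: cB.
have dE i j : j < 6 -> dig B j (e i) = nth 0 (c i) j.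
  by move=> lt_j; apply: dig_num lt_j => k; exact: cB.
have srcS i : esrc B (e i.+1) = edst B (e i) by rewrite /esrc /edst !dE.
have eV i : vedge K n O I B (e i).
  by rewrite /vedge !dE //= !capcode_lt Ig (compat_fires K0 (Hf i)) (O_fires OP (Hf
    i)).
have [F [N HN HF]] := infinitely_often eE.
exists F => [|lam pi chi]; first by exists (e N); rewrite ?HN ?eV.
apply/negP => /orP[/andP[/bAP H1 /bEP[x _ /andP[/andP[Fx _] lt_x]]]|
                   /andP[/bAP H1 /bEP[x _ /bEP[y _ /andP[/andP[/andP[Fx _] /andP[Fy
                     _]]]]]]].
  (* The ranking function along the run: from [N] on it never increases, and it drops at each of the
     infinitely many occurrences of [x]. *)
  pose phi i := \sum_t lam (nat_of_ord t) * (g i).2 t + pi (esrc B (e i)).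
  (* Where the digit is [K], and so possibly capped, [lam] vanishes; elsewhere the digit is the true
     multiplicity. *)
  have lamz i : N <= i -> \sum_t lam (nat_of_ord t) * v i t =
      bS n (fun t => lam t * dig K.+1 t (dig B 3 (e i))).
    move=> le_i; have := H1 _ (eE i); rewrite HN // eV /= => /andP[/bAP Hz _].
    apply: eq_bigr => t _; have := Hz t (ltn_ord t); rewrite dE //= dig_bagcode.
    by case: eqP => [_ /eqP-> //|ne _]; congr (_ * _); move: ne; rewrite minnE; lia.
  have phiS i : N <= i -> phi i.+1 + lam (dig B 2 (e i)) + pi (esrc B (e i)) =
     phi i + (bS n (fun t => lam t * dig K.+1 t (dig B 3 (e i))) + pi (edst B (e
       i))).
    move=> le_i; rewrite -lamz // /phi srcS dE //=.
    have : \sum_t lam (nat_of_ord t) * ((g i.+1).2 t + (t == s i)) =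
           \sum_t lam (nat_of_ord t) * ((g i).2 t + v i t).
      by apply: eq_bigr => t _; case: (Hf i) => _ _ ->.
    rewrite !(eq_bigr _ (fun t _ => mulnDr _ _ _)) !big_split /=.
    have -> : \sum_t lam (nat_of_ord t) * (t == s i) = lam (s i).
      rewrite (bigD1 (s i)) //= eqxx muln1 big1 ?addn0 // => t /negPf ->.
      by rewrite muln0.
    lia.
  apply: (@no_infinite_descent phi N) => i le_i.
    have := H1 _ (eE i); rewrite HN // eV /= => /andP[_].
    have := phiS i le_i; lia.
  have [j le_ij Ej] := HF x i Fx; exists j => //.
  by have := phiS j (leq_trans le_i le_ij); rewrite Ej; lia.
(* In the second alternative, [chi] is constant on the tail of the run, since consecutive edges
   share a node; but every edge of [F] occurs in this tail. *)
have chiS i : chi (esrc B (e (N + i))) = chi (esrc B (e N)).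
  elim: i => [|i <-]; rewrite ?addn0 // addnS srcS.
  by have := H1 _ (eE (N + i)); rewrite HN ?leq_addr // eV => /eqP.
have chiF z : F z -> chi (esrc B z) = chi (esrc B (e N)).
  by move=> Fz; have [j le_j <-] := HF z N Fz; rewrite -(subnKC le_j).
by rewrite !chiF // eqxx.
Qed.

(** * Completeness of ranking certificates *)

Section Completeness.
Notation U := (diverges Post).
(** For large [K], [stab] is provided by [cap_threshold] and [pump] by [pump_threshold]. *)
Hypothesis stab : forall d m, U (d, m) -> U (d, mcap K m).
Hypothesis pump : forall d s d' v N, Post d s d' v ->
  exists2 v', Post d s d' v' &
    forall t, (v t < K -> v t <= v' t) /\ (K <= v t -> N <= v' t).
Hypothesis IP : forall (d : 'I_nD) x, x < K.+1 ^ n ->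
  I d x = `[< ~ U (d, vec K n x) >].

Let ok e := vedge K n O I B e.

Lemma ok_fields e : ok e -> exists (d : 'I_nD) (s : 'I_n) (d' : 'I_nD) v,
  [/\ [/\ dig B 0 e = d, dig B 2 e = s & dig B 4 e = d'], Post d s d' v,
      dig B 3 e = bagcode v, ~ U (d, vec K n (dig B 1 e)) &
      compat K n (dig B 1 e) s (bagcode v) (dig B 5 e)].
Proof.
move=> /andP[/andP[/andP[/andP[ltx _] Ie] Hc] /OP[d [s [d' [v [[Ed Es Ed'] HP
  Ez]]]]]].
have {}Ez : dig B 3 e = bagcode v := Ez.
exists d, s, d', v; split=> //; last by rewrite -Ez -Es.
by apply/asboolP; rewrite -IP // -Ed.
Qed.

Lemma esrcK e : 0 < B -> esrc B e %% B = dig B 0 e /\ esrc B e %/ B = dig B 1 e.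
Proof.
move=> B0; have lt0 : dig B 0 e < B by rewrite ltn_mod.
by rewrite /esrc addnC modnMDl divnMDl // modn_small // divn_small // addn0.
Qed.

Lemma edstK e : 0 < B -> edst B e %% B = dig B 4 e /\ edst B e %/ B = dig B 5 e.
Proof.
move=> B0; have lt0 : dig B 4 e < B by rewrite ltn_mod.
by rewrite /edst addnC modnMDl divnMDl // modn_small // divn_small // addn0.
Qed.

Let B0 : 0 < B. Proof. by apply: leq_trans BM; rewrite expn_gt0. Qed.

Definition tame (d : nat) (m : multiset n) : Prop :=
  forall d0 : 'I_nD, d = d0 -> ~ U (d0, m).

Lemma tame_raise d m m' : tame d m -> mcap K m' = mcap K m -> tame d m'.
Proof.
move=> Ht E d0 Ed /stab; rewrite E => /(diverges_upward (c' := (d0, m))) H.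
apply: (Ht d0 Ed); apply: H; split=> // t; rewrite ffunE; exact: geq_minr.
Qed.

(* Coordinates that meet the cap along a walk can be raised arbitrarily,
   since the set of terminating configurations only depends on capped bags. *)
Lemma raise_walk N (p : seq nat) (x y : nat) (m : multiset n) :
  walk (esrc B) (edst B) x p y -> all ok p ->
  tame (x %% B) m -> (forall t, vec K n (x %/ B) t <= m t) ->
  exists m', [/\ tame (y %% B) m', forall t, vec K n (y %/ B) t <= m' t &
    forall t : 'I_n, N + size p <= m t \/
       has (fun e => dig K.+1 t (dig B 1 e) == K) p -> N <= m' t].
Proof.
elim: p x m => [|e p IH] x m /=.
  move=> /eqP <- _ Tm le_m; exists m; split=> // t [|//].
  by rewrite addn0.
case/andP=> /eqP Ex Wp /andP[/ok_fields[d [s [d' [v [[Ed Es Ed'] HP Ez nU /bAP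
  Hc]]]]] okp].
rewrite -Ex (esrcK e B0).1 (esrcK e B0).2 => Tm le_m.
(* Each edge consumes at most one copy of a letter, so adding [(N + size p).+1] copies leaves [N] of
   them after this edge and the walk [p]. *)
pose m0 : multiset n :=
  [ffun t : 'I_n => m t + (dig K.+1 t (dig B 1 e) == K) * (N + size p).+1].
have Tm0 : tame d m0.
  rewrite -Ed; apply: tame_raise Tm _; apply/ffunP => t; rewrite !ffunE.
  have := le_m t; rewrite ffunE; case: eqP => [->|_] /=; rewrite ?addn0 // !minnE;
    lia.
have ms : 0 < m0 s.
  have /andP[H _] := Hc s (ltn_ord s); have := le_m s; move: H.
  by rewrite !ffunE eqxx; lia.
have [||m' [Tm' le_m' H']] := IH _ (fire m0 s v) Wp okp.
- rewrite (edstK e B0).1 Ed' => d0 /val_inj <- /(diverges_backward _) H.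
  by apply: (Tm0 d erefl); apply: H; exists s, v; exact: fireP.
- rewrite (edstK e B0).2 => t; have := Hc t (ltn_ord t); have := le_m t.
  rewrite !ffunE dig_bagcode -[t == s :> nat]/(t == s) !minnE.
  case: (dig K.+1 t (dig B 1 e) =P K) => [->|_]; case: (t == s) => /=; lia.
exists m'; split=> // t H; apply: H'.
case: H => [le_N|/orP[/eqP E|Hh]]; [left|left|by right].
  by rewrite !ffunE; case: (t == s); case: (dig _ _ _ == K) => /=; lia.
by rewrite !ffunE E eqxx; case: (t == s) => /=; lia.
Qed.

(** A capped letter is credited with [N], the amount to which [pump] can raise it. *)
Definition gain N (t e : nat) : nat :=
  if dig K.+1 t (dig B 3 e) == K then N else dig K.+1 t (dig B 3 e).

(** The bag dominates [m] plus everything gained on [p] minus everything consumed; consumption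
    stands on the right to avoid truncated subtraction. *)
Definition gained N (m : multiset n) (y : nat) (p : seq nat) (c : conf) : Prop :=
  c.1 = y %% B :> nat /\ forall t : 'I_n,
    m t + \sum_(e <- p) gain N t e <= c.2 t + \sum_(e <- p) (t == dig B 2 e :> nat).

Lemma eventually_imp (Q Q' : conf -> Prop) c : (forall c, Q c -> Q' c) ->
  eventually Post Q c -> eventually Post Q' c.
Proof.
move=> QQ'; elim=> [{}c /QQ'|c1 c2 s12 _ IH]; first exact: Ev_now.
exact: Ev_step s12 IH.
Qed.

(** Outside [Om] the abstract bags on the walk are uncapped and bound the concrete ones from below.
    For a letter in [Om], [size p] copies suffice, since each step consumes at most one. *)
Lemma pump_walk N (Om : pred 'I_n) (p : seq nat) (x y : nat) (d : 'I_nD) (m :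
  multiset n) :
  walk (esrc B) (edst B) x p y -> all ok p -> x %% B = d -> K <= N ->
  (forall t e, e \in p -> ~~ Om t -> dig K.+1 t (dig B 1 e) != K) ->
  (forall t, ~~ Om t -> vec K n (x %/ B) t <= m t) ->
  (forall t, Om t -> size p <= m t) ->
  (p = [::] /\ gained N m y p (d, m)) \/
  (exists2 c1, step Post (d, m) c1 & eventually Post (gained N m y p) c1).
Proof.
elim: p x d m => [|e p IH] x d m /=.
  move=> /eqP <- _ Ex _ _ _ _; left; split=> //; split=> // t.
  by rewrite !big_nil.
case/andP=> /eqP Ex Wp.
move=> /andP[/ok_fields[d0 [s [d' [v [[Ed Es Ed'] HP Ez nU /bAP Hc]]]]] okp] xd KN
  HOm le_m Om_m.
have E0 : d0 = d by apply: val_inj; rewrite /= -Ed -xd -Ex (esrcK e B0).1.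
subst d0; right.
have HOme t : ~~ Om t -> dig K.+1 t (dig B 1 e) != K by apply: HOm; exact: mem_head.
move: le_m; rewrite -Ex (esrcK e B0).2 => le_m.
have ms : 0 < m s.
  have /andP[H _] := Hc s (ltn_ord s).
  case: (boolP (Om s)) => [/Om_m|nO]; first by lia.
  by have := le_m s nO; move: H; rewrite !ffunE eqxx; lia.
have [v' HP' le_v'] := pump N HP.
exists (d', fire m s v'); first by exists s, v'; exact: fireP.
have vg (t : 'I_n) : gain N t e <= v' t.
  by rewrite /gain Ez dig_bagcode; have [] := le_v' t; rewrite minnE; case: eqP;
    lia.
have imp c : gained N (fire m s v') y p c -> gained N m y (e :: p) c.
  move=> [Ec H]; split=> // t; have := H t; rewrite !big_cons ffunE Es.
  rewrite -[t == s :> nat]/(t == s).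
  by have := vg t; case: eqP => [->|_] /=; lia.
have [] := IH _ d' (fire m s v') Wp okp.
- by rewrite (edstK e B0).1.
- by [].
- by move=> t f fp; apply: HOm; rewrite inE fp orbT.
- move=> t nO; rewrite (edstK e B0).2; have := Hc t (ltn_ord t).
  have := le_m t nO; have := HOme t nO; have := le_v' t.
  rewrite !ffunE dig_bagcode -[t == s :> nat]/(t == s) !minnE.
  by case: (t == s); lia.
- by move=> t /Om_m; rewrite !ffunE; case: (t == s); lia.
- by move=> [_ H]; apply: Ev_now; exact: imp.
move=> [c1 s1 H1]; apply: Ev_step s1 _; exact: eventually_imp H1.
Qed.

Lemma sum_multiples (f h : nat -> nat) (s : seq nat) :
  \sum_(e <- flatten [seq nseq (f e) e | e <- s]) h e = \sum_(e <- s) f e * h e.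
Proof.
rewrite big_flatten big_map; apply: eq_bigr => e _.
by rewrite big_nseq iter_addn addn0 mulnC.
Qed.

Lemma count_sum (P : pred nat) (l : seq nat) : count P l = \sum_(e <- l) P e.
Proof. by rewrite -sum1_count big_mkcond; apply: eq_bigr => e _; case: (P e). Qed.

Lemma rank_complete (F : nat -> bool) :
  (exists2 e, e < B ^ 6 & F e && ok e) ->
  exists lam pi chi, rank_ok K n B (fun e => F e && ok e) lam pi chi.
Proof.
set G := fun e => F e && ok e => -[e0 lt0 F0]; apply: contrapT => nrank.
pose s := [seq e <- iota 0 (B ^ 6) | G e].
have memS e : (e \in s) = G e && (e < B ^ 6) by rewrite mem_filter mem_iota.
have conn (chi : nat -> bool) :
    (forall e, e \in s -> chi (esrc B e) = chi (edst B e)) ->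
    forall e e', e \in s -> e' \in s -> chi (esrc B e) = chi (esrc B e').
  move=> Hchi e e'; rewrite !memS => /andP[Ge lte] /andP[Ge' lte'].
  apply: contrapT => ne; apply: nrank.
  exists (fun=> 0), (fun=> 0), (fun x => chi x : nat); apply/orP; right.
  apply/andP; split.
    by apply/bAP => x lt_x; apply/implyP => Gx; rewrite Hchi ?memS ?Gx.
  apply/bEP; exists e => //; apply/bEP; exists e' => //; rewrite Ge Ge' /=.
  by apply/eqP; move: ne; case: (chi (esrc B e)); case: (chi (esrc B e')).
have bnd a b : dig B a b < B by rewrite ltn_mod.
have bnd2 a b c d : dig B a b + dig B c d * B < B ^ 2.
  by have := bnd a b; have := bnd c d; rewrite expnS expn1; nia.
have okS e : e \in s -> ok e by rewrite memS => /andP[/andP[]].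
pose Z t := has (fun e => dig K.+1 t (dig B 3 e) == K) s.
have us : uniq s by rewrite filter_uniq ?iota_uniq.
case: (@ranking_or_circulation n (B ^ 2) s (fun e t => dig K.+1 t (dig B 3 e))
  (dig B 2) (esrc B) (edst B) Z us).
- by move=> e /okS/ok_fields[d [s0 [d' [v [[_ -> _] _ _ _ _]]]]].
- by move=> e _; exact: bnd2.
- by move=> e _; exact: bnd2.
- move=> [lam [pi [HZ Hle [e es Hlt]]]]; apply: nrank.
  exists lam, pi, (fun=> 0); apply/orP; left; apply/andP; split; last first.
    by move: es; rewrite memS => /andP[Ge lte]; apply/bEP; exists e; rewrite ?Ge.
  apply/bAP => x lt_x; apply/implyP => Gx; rewrite Hle ?memS ?Gx // andbT.
  apply/bAP => t lt_t; apply/implyP => Hz; rewrite HZ //.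
  by apply/hasP; exists x; rewrite ?memS ?Gx.
move=> [f [f0 fgain fbal]].
(* The circulation as a list of edges with multiplicities; conservation at the nodes says that it is
   balanced. *)
pose l := flatten [seq nseq (f e) e | e <- s].
have meml e : (e \in l) = (e \in s).
  apply/flatten_mapP/idP => [[x xs]|es]; first by rewrite mem_nseq => /andP[_
    /eqP->].
  by exists e => //; rewrite mem_nseq f0 //=.
have e0s : e0 \in s by rewrite memS lt0 andbT.
have l0 : l != [::] by have := meml e0; rewrite e0s; case: (l).
have lbal : balanced (esrc B) (edst B) l.
  by move=> v; rewrite !count_sum !sum_multiples; exact: fbal.
have lconn (chi : nat -> bool) :
    (forall e, e \in l -> chi (esrc B e) = chi (edst B e)) ->
    forall e e', e \in l -> e' \in l -> chi (esrc B e) = chi (esrc B e').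
  move=> Hchi e e'; rewrite !meml; apply: conn => x xs; apply: Hchi.
  by rewrite meml.
have [x [p [Pp Wp]]] := euler l0 lbal lconn.
have memp e : (e \in p) = (e \in s) by rewrite (perm_mem Pp) meml.
have okp : all ok p by apply/allP => e; rewrite memp => /okS.
have [e1 [q Ep]] : exists e1 q, p = e1 :: q.
  by have := memp e0; rewrite e0s; case: (p) => // a b _; exists a, b.
have Ex : esrc B e1 = x by move: Wp; rewrite Ep /= => /andP[/eqP].
have /okS/ok_fields[d [s0 [d' [v [[Ed _ _] _ _ nU _]]]]] : e1 \in s.
  by rewrite -memp Ep mem_head.
have xd : x %% B = d by rewrite -Ex (esrcK e1 B0).1.
have xX : x %/ B = dig B 1 e1 by rewrite -Ex (esrcK e1 B0).2.
(* A first traversal of the closed walk raises all letters that meet the cap to at least [size p],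
   as [pump_walk] requires, and stays among the nondiverging configurations. *)
have [||m [Tm le_m Hm]] := raise_walk (size p) (m := vec K n (dig B 1 e1)) Wp okp.
- by rewrite xd => d0 /val_inj <-.
- by move=> t; rewrite xX.
pose Om (t : 'I_n) := has (fun e => dig K.+1 t (dig B 1 e) == K) p.
have := pump_walk (N := size p + K) (Om := Om) (m := m) Wp okp xd (leq_addl _ _).
case.
- by move=> t e ep /hasPn/(_ e ep).
- by move=> t _; exact: le_m.
- by move=> t Ot; apply: Hm; right.
- by rewrite Ep => -[].
move=> [c1 s1 H1]; apply: (Tm d xd); apply: (self_covering_diverges s1).
apply: eventually_imp H1 => c [Ec Hc]; split; first by apply: val_inj; rewrite /=
  Ec xd.
move=> t; have := Hc t; suff : \sum_(e <- p) (t == dig B 2 e :> nat)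
    <= \sum_(e <- p) gain (size p + K) t e.
  by move: (\sum_(e <- p) _) (\sum_(e <- p) _) => S1 S2 /=; lia.
(* For a letter in [Z], a single pumped edge gains [size p + K], more than the walk can consume. For
   other letters the gain is given by the digits, and the circulation has nonnegative effect. *)
case: (boolP (Z t)) => [/hasP[e es Hz]|nZ].
  apply: (@leq_trans (size p)).
    rewrite -sum1_size; apply: leq_sum => x' _; exact: leq_b1.
  have ep : e \in p by rewrite memp.
  by rewrite (big_rem e) //= {1}/gain Hz; lia.
have -> : \sum_(e <- p) gain (size p + K) t e =
    \sum_(e <- p) dig K.+1 t (dig B 3 e).
  apply: eq_big_seq => e; rewrite memp => es; rewrite /gain.
  by case: ifP => // Hz; case/hasP: nZ; exists e.
by rewrite !(perm_big _ Pp) /= !sum_multiples; apply: fgain.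
Qed.

End Completeness.

End Termination.

(** * The capped Parikh automaton *)

Lemma map_codom_mkseq n (T U : Type) (f : 'I_n -> T) (h : T -> U) (g : nat -> U) :
  (forall i, h (f i) = g i) -> map h (codom f) = mkseq g n.
Proof.
move=> E; rewrite codomE -map_comp /mkseq -val_enum_ord -map_comp.
by apply: eq_map => i /=.
Qed.

Lemma pickle_codom n (T : countType) (f : 'I_n -> T) (g : nat -> nat) :
  (forall i, pickle (f i) = g i) -> pickle (codom f) = CodeSeq.code (mkseq g n).
Proof. by move=> E; rewrite -(map_codom_mkseq E). Qed.

(** A state codes the capped counts of the letters read so far. Reading [a] increments digit [a]
    unless it has reached [K]; the second test keeps the result a state. *)
Definition count_up (K n i a : nat) : nat :=
  if (dig K.+1 a i < K) && (i + K.+1 ^ a < K.+1 ^ n) then i + K.+1 ^ a else i.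

Lemma count_up_lt K n (i : 'I_(K.+1 ^ n)) a : count_up K n i a < K.+1 ^ n.
Proof. by rewrite /count_up; case: ifP => // /andP[]. Qed.

Lemma states_gt0 K n : 0 < K.+1 ^ n.
Proof. by rewrite expn_gt0. Qed.

Definition cap_dfa (K n z : nat) : dfa n :=
  @Dfa n (K.+1 ^ n) (Ordinal (states_gt0 K n))
    (fun i a => Ordinal (count_up_lt i a)) (fun i => i == z :> nat).

Definition count_table (K n : nat) : nat :=
  CodeSeq.code (mkseq (fun i => CodeSeq.code (mkseq (count_up K n i) n)) (K.+1 ^
    n)).

Lemma encode_cap_dfa K n z : encode_dfa (cap_dfa K n z) =
  [:: K.+1 ^ n; 0; count_table K n; CodeSeq.code (mkseq (fun i => i == z : nat)
    (K.+1 ^ n))].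
Proof.
rewrite /encode_dfa /encode1 /encode2 /count_table /=; congr [:: _; _; _; _].
  by apply: pickle_codom => i; exact: pickle_codom.
by apply: pickle_codom => i; case: (_ == _).
Qed.

Lemma cap_dfa_run K n z (w : seq 'I_n) :
  foldl (@dfa_step n (cap_dfa K n z)) (dfa_init (cap_dfa K n z)) w =
  capcode K n (fnat (parikh w)) :> nat.
Proof.
elim/last_ind: w => [|w a IH].
  by rewrite /= /capcode /num /bS big1 // => t _; rewrite fnatE ffunE minn0.
rewrite -cats1 foldl_cat /= /count_up IH cats1 dig_capcode // fnatE ffunE.
have E : capcode K n (fnat (parikh (rcons w a))) =
    capcode K n (fnat (parikh w)) + (count_mem a w < K) * K.+1 ^ a.
  rewrite /capcode /num /bS (bigD1 a) //= [in RHS](bigD1 a) //=.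
  rewrite !fnatE !ffunE -cats1 count_cat /= eqxx.
  rewrite (eq_bigr (fun t : 'I_n => minn K (fnat (parikh w) t) * K.+1 ^ t)).
    by rewrite [RHS]addnAC -mulnDl; congr (_ * _ + _); rewrite -/(count_mem a w)
      addn0 !minnE;
      move: (count_mem a w) => c; case: (ltnP c K) => /=; lia.
  move=> t /negPf ne; rewrite !fnatE !ffunE count_cat /= eq_sym ne.
  by rewrite !addn0.
have := capcode_lt K n (fnat (parikh (rcons w a))).
rewrite E gtn_min ltnn /=.
by case: (count_mem a w < K); rewrite ?mul1n ?mul0n ?addn0 // => ->.
Qed.

Lemma cap_dfaP K n z (w : seq 'I_n) :
  dfa_accepts (cap_dfa K n z) w = (capcode K n (fnat (parikh w)) == z).
Proof. by rewrite /dfa_accepts /= cap_dfa_run. Qed.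

(** * Asynchronous programs as instances *)

Definition prog (C : language_class) : ctx :=
  @Ctx (async_program C) (@encode_program C) 5 (fun=> erefl).

Section Program.
Variable C : language_class.
Implicit Type P : async_program C.

Definition post P (d : 'I_(num_states P)) (s : 'I_(num_handlers P))
    (d' : 'I_(num_states P)) (v : multiset (num_handlers P)) : Prop :=
  exists2 w, lang (handler d s d') w & parikh w = v.

Lemma transitionP P (c : config P) s c' :
  transition c s c' <-> exists v, fires (@post P) c s v c'.
Proof.
split=> [[m [w [Em Hw Em']]]|[v [[w Hw Ew] cs E]]].
  exists (parikh w); split; first by exists w.
    by rewrite Em !ffunE eqxx addn1.
  by move=> t; rewrite Em Em' !ffunE addnAC.
exists [ffun t => c.2 t - (t == s)], w; split=> //.
  apply/ffunP => t; rewrite !ffunE; case: eqP => [->|_] /=; lia.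
apply/ffunP => t; rewrite !ffunE; have := E t; rewrite -Ew !ffunE.
case: eqP => [->|_] /=; lia.
Qed.

Lemma stepP P (c c' : config P) :
  step (@post P) c c' <-> exists s, transition c s c'.
Proof.
split=> [[s [v H]]|[s /transitionP[v H]]]; exists s; last by exists v.
by apply/transitionP; exists v.
Qed.

Lemma reachableP P (df : 'I_(num_states P)) :
  (exists m, reachable (df, m)) <->
  eventually (@post P) (fun c => c.1 = df) (init_config P).
Proof.
split=> [[m [len [c [i [[c0 cS] le_i ci]]]]]|/eventually_path[l [g [g0 gS gl]]]].
  rewrite -c0; apply: (@path_eventually _ _ _ _ _ i); last by rewrite ci.
  move=> j lt_j; apply/stepP/cS; case: (len) le_i => //= l.
  exact: leq_trans.
exists (g l).2, (Some l), g, l; split=> //=; last by rewrite -gl; case: (g l).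
by split=> // i lt_i; apply/stepP/gS.
Qed.

Lemma terminatingP P : terminating P <-> ~ diverges (@post P) (init_config P).
Proof.
split=> [H [g [g0 gS]]|nD [l|] c [c0 cS]]; last 2 first.
- by exists l.
- by case: nD; exists c; split=> // i; apply/stepP/cS.
by have [] // := H None g; split=> // i _; apply/stepP/gS.
Qed.

(** Defined on all numbers and false when they do not denote a context, because certificate checks
    quantify over numbers. *)
Definition oracle P (K d s d' z : nat) : bool :=
  `[< exists d0 s0 d0' v, [/\ [/\ d = nat_of_ord d0, s = nat_of_ord s0 &
      d' = nat_of_ord d0'], @post P d0 s0 d0' v &
      z = capcode K (num_handlers P) (fnat v)] >].

Lemma oracleP P K d s d' z : oracle P K d s d' z <->
  exists d0 s0 d0' v, [/\ [/\ d = nat_of_ord d0, s = nat_of_ord s0 &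
    d' = nat_of_ord d0'], @post P d0 s0 d0' v &
    z = capcode K (num_handlers P) (fnat v)].
Proof. by split=> /asboolP. Qed.

Definition handler_code P : nat := encode3 (@handler C P).
Definition bag_code P : nat := encode1 (init_bag P).

Lemma handler_codeP P (d d' : 'I_(num_states P)) (s : 'I_(num_handlers P)) :
  nthc (nthc (nthc (handler_code P) d) s) d' = pickle (handler d s d').
Proof.
have nthE (n : nat) (T : countType) (f : 'I_n -> T) (i : 'I_n) :
    nthc (pickle (codom f)) i = pickle (f i).
  rewrite [pickle _]/(CodeSeq.code _) nthc_code.
  by rewrite codomE -map_comp (nth_map i) ?size_enum_ord // nth_ord_enum.
by rewrite /handler_code /encode3 !nthE.
Qed.

Lemma bag_codeP P t : nthc (bag_code P) t = fnat (init_bag P) t.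
Proof. by rewrite /bag_code [encode1 _]/(CodeSeq.code _) nthc_code map_id. Qed.

Section Components.
Variables (G : ctx) (P : G -> prog C).
Hypothesis HP : computablem P.

Lemma computable_num_states : computable (fun t => num_states (P t)).
Proof.
by apply: (@computable_subst G (prog C) P (fun Q => num_states Q)) HP; exists (Proj
  0).
Qed.

Lemma computable_num_handlers : computable (fun t => num_handlers (P t)).
Proof.
by apply: (@computable_subst G (prog C) P (fun Q => num_handlers Q)) HP; exists
  (Proj 1).
Qed.

Lemma computable_handler_code : computable (fun t => handler_code (P t)).
Proof. by apply: (@computable_subst G (prog C) P handler_code) HP; exists (Proj 2).
  Qed.

Lemma computable_init_state : computable (fun t => init_state (P t) : nat).
Proof.
by apply: (@computable_subst G (prog C) P (fun Q => init_state Q : nat)) HP; exists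
  (Proj 3).
Qed.

Lemma computable_init_bag (F : G -> nat) :
  computable F -> computable (fun t => fnat (init_bag (P t)) (F t)).
Proof.
move=> HF; apply: computable_ext (computable_nthc _ HF) => [t|]; first exact:
  bag_codeP.
by apply: (@computable_subst G (prog C) P bag_code) HP; exists (Proj 4).
Qed.

End Components.

Definition valid P (K d s d' z : nat) : bool :=
  (d < num_states P) && (s < num_handlers P) && (d' < num_states P) &&
  (z < K.+1 ^ num_handlers P).

Lemma oracle_valid P K d s d' z : oracle P K d s d' z -> valid P K d s d' z.
Proof.
move=> /asboolP[d0 [s0 [d0' [v [[-> -> ->] _ ->]]]]].
by rewrite /valid !ltn_ord capcode_lt.
Qed.

Hypothesis interC : effectively_closed_regular_inter C.
Hypothesis emptyC : emptiness_decidable C.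

Let G5 := ext (ext (ext (ext (ext (prog C))))).
Let pP (p : G5) : prog C := p.1.1.1.1.1.
Let pK (p : G5) := p.1.1.1.1.2.
Let pd (p : G5) := p.1.1.1.2.
Let ps (p : G5) := p.1.1.2.
Let pd' (p : G5) := p.1.2.
Let pz (p : G5) := p.2.
Let pvalid p := valid (pP p) (pK p) (pd p) (ps p) (pd' p) (pz p).
Let poracle p := oracle (pP p) (pK p) (pd p) (ps p) (pd' p) (pz p).

Lemma computablev_oracle_args : computablev (fun p : G5 =>
  [:: num_handlers (pP p);
      nthc (nthc (nthc (handler_code (pP p)) (pd p)) (ps p)) (pd' p);
      (pK p).+1 ^ num_handlers (pP p); 0; count_table (pK p) (num_handlers (pP p));
      CodeSeq.code (mkseq (fun i => i == pz p : nat)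
        ((pK p).+1 ^ num_handlers (pP p)))]).
Proof.
have HP : computablem pP by rewrite /pP; computability.
have HN := computable_num_handlers HP.
have HK : computable pK by rewrite /pK; computability.
have Hd : computable pd by rewrite /pd; computability.
have Hs : computable ps by rewrite /ps; computability.
have Hd' : computable pd' by rewrite /pd'; computability.
have Hz : computable pz by rewrite /pz; computability.
have HM : computable (fun p : G5 => (pK p).+1 ^ num_handlers (pP p)) by
  computability.
do !apply: computablev_cons; last exact: computablev_nil.
all: rewrite ?/count_table ?/count_up; try by computability.
- do !apply: computable_nthc => //; exact: computable_handler_code HP.
Qed.

(** [z] is posted exactly if the handler's language meets that of [cap_dfa] for [z]. The procedures
    for intersection and emptiness are specified only on codes of representations, hence the guard
    by [pvalid]. *)
Lemma computableb_oracle5 : computableb poracle.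
Proof.
have [args Hargs] := @computablev_val G5 pvalid _ computablev_oracle_args.
have [fi Hfi] := interC; have [fe Hfe] := emptyC.
apply: (@computableb_ext _ (fun p => pvalid p && ~~ ~~ poracle p)).
  move=> p; rewrite negbK; case E: (poracle p); last by rewrite andbF.
  by rewrite andbT; exact: oracle_valid E.
apply: computableb_guard.
  have HP : computablem pP by rewrite /pP; computability.
  have HN := computable_num_handlers HP; have HS := computable_num_states HP.
  by rewrite /pvalid /valid /pK /pd /pd' /ps /pz; computability.
apply: computableb_not; exists (Comp fe [:: nth Zero args 0; Comp fi args]) => t.
move: (Hargs t) (valP t); move: (ctx_enc t) (val t) => xs p; move=> {t}.
rewrite /pvalid /poracle.
move: (pP p) (pK p) (pd p) (ps p) (pd' p) (pz p) => P K d s d' z {p} Hev.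
move=> /andP[/andP[/andP[lt_d lt_s] lt_d'] lt_z].
move: Hev; rewrite -[d]/(nat_of_ord (Ordinal lt_d)) -[s]/(nat_of_ord (Ordinal
  lt_s)).
rewrite -[d']/(nat_of_ord (Ordinal lt_d')) handler_codeP.
move: (Ordinal lt_d) (Ordinal lt_s) (Ordinal lt_d') => {d lt_d}d {s lt_s}s {d'
  lt_d'}d'.
rewrite -encode_cap_dfa => Hev.
have [r' [Hr' Lr']] := Hfi _ (handler d s d') (cap_dfa K _ z).
have [E1 E0] := Hfe (existT (fun n => rep C n : Type) _ r').
apply: (@eval_Comp _ _ _ [:: num_handlers P; pickle r']).
  split; last by split=> //; exact: eval_Comp Hev Hr'.
  by case: (args) Hev => //= a l [].
case: (boolP (oracle P K d s d' z)) => [/asboolP|nO].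
  move=> [d0 [s0 [d0' [v [[/val_inj Ed /val_inj Es /val_inj Ed'] [w Hw Ew] Ez]]]]].
  apply: E0 => /(_ w); apply; apply/Lr'; rewrite Ed Es Ed'; split=> //.
  by rewrite cap_dfaP Ew Ez.
apply: E1 => w /Lr'[Hw]; rewrite cap_dfaP => /eqP Ez; move/asboolP: nO; apply.
by exists d, s, d', (parikh w); split=> //; exists w.
Qed.

Lemma computableb_oracle (G : ctx) (P : G -> prog C) (K d s d' z : G -> nat) :
  computablem P -> computable K -> computable d -> computable s -> computable d' ->
    computable z ->
  computableb (fun t => oracle (P t) (K t) (d t) (s t) (d' t) (z t)).
Proof.
move=> HP HK Hd Hs Hd' Hz.
apply: (@computable_subst G G5 (fun t => (P t, K t, d t, s t, d' t, z t)) _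
  computableb_oracle5).
by do !apply: computablem_pair.
Qed.

End Program.

(** * Certificates *)

Section Certificates.
Variable C : language_class.
Implicit Type P : async_program C.

(** A common base in which states, handlers and capped bags are all single digits. *)
Definition bound P K : nat :=
  num_states P + num_handlers P + K.+1 ^ num_handlers P.

Definition path_ok P K l b D X : bool :=
  (0 < K) &&
  pathcheck K (num_handlers P) (oracle P K) (init_state P) (fnat (init_bag P))
    l (fun i => dig b i D) (fun i => dig b i X).

Definition in_table P K I d x : bool := dig 2 (d + x * bound P K) I == 1.

Definition inv_ok P K I : bool :=
  (0 < K) &&
  invcheck K (num_states P) (num_handlers P) (oracle P K) (init_state P)
    (capcode K (num_handlers P) (fnat (init_bag P))) (in_table P K I).

Definition edge_in P K I F e : bool :=
  (dig 2 e F == 1) &&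
  vedge K (num_handlers P) (oracle P K) (in_table P K I) (bound P K) e.

(** Here and below, [y] is merely a common bound for the components of the certificate, so no
    tupling is required. *)
Definition unsafe_cert P df y : bool :=
  bE y (fun K => bE y (fun l => bE y (fun b => bE y (fun D => bE y (fun X =>
    path_ok P K l b D X && (dig b l D == df)))))).

Definition loop_cert P y : bool :=
  bE y (fun K => bE y (fun l => bE y (fun b => bE y (fun D => bE y (fun X =>
    path_ok P K l b D X &&
    bE l (fun i => (dig b i D == dig b l D) &&
      bA (num_handlers P) (fun t =>
        dig K.+1 t (dig b i X) <= dig K.+1 t (dig b l X)))))))).

Definition safe_cert P df y : bool :=
  bE y (fun K => bE y (fun I => inv_ok P K I &&
    bA (K.+1 ^ num_handlers P) (fun x => ~~ in_table P K I df x))).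

Definition rank_cert P K I F y : bool :=
  bE (bound P K ^ 6) (edge_in P K I F) ==>
  bE y (fun b => bE y (fun lam => bE y (fun pi => bE y (fun chi =>
    rank_ok K (num_handlers P) (bound P K) (edge_in P K I F)
      (fun t => dig b t lam) (fun v => dig b v pi) (fun v => dig b v chi))))).

Definition term_cert P y : bool :=
  bE y (fun K => bE y (fun I => inv_ok P K I &&
    bA (2 ^ (bound P K ^ 6)) (fun F => rank_cert P K I F y))).

Section Computability.
Hypothesis interC : effectively_closed_regular_inter C.
Hypothesis emptyC : emptiness_decidable C.

Local Ltac computability_hook ::=
  lazymatch goal with
  | |- computable (fun t => dig (@?b t) (@?s t) (@?x t)) =>
      refine (@computable_dig _ b s x _ _ _)
  | |- computable (fun t => num (@?b t) (@?k t) (@?f t)) => rewrite /num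
  | |- computable (fun t => num_states (@?P t)) =>
      refine (@computable_num_states C _ P _)
  | |- computable (fun t => num_handlers (@?P t)) =>
      refine (@computable_num_handlers C _ P _)
  | |- computable (fun t => nat_of_ord (init_state (@?P t))) =>
      refine (@computable_init_state C _ P _)
  | |- computable (fun t => fnat (init_bag (@?P t)) (@?F t)) =>
      refine (@computable_init_bag C _ P _ F _)
  | |- computableb (fun t => oracle (@?P t) (@?K t) (@?d t) (@?s t) (@?d' t) (@?z
    t)) =>
      refine (@computableb_oracle C interC emptyC _ P K d s d' z _ _ _ _ _ _)
  end.

Variables (G : ctx) (P : G -> prog C) (df y : G -> nat).
Hypotheses (HP : computablem P) (Hdf : computable df) (Hy : computable y).

Lemma computableb_unsafe : computableb (fun t => unsafe_cert (P t) (df t) (y t)).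
Proof. rewrite /unsafe_cert /path_ok /pathcheck /exact; computability. Qed.

Lemma computableb_loop : computableb (fun t => loop_cert (P t) (y t)).
Proof. rewrite /loop_cert /path_ok /pathcheck /exact; computability. Qed.

Lemma computableb_safe : computableb (fun t => safe_cert (P t) (df t) (y t)).
Proof.
rewrite /safe_cert /inv_ok /in_table /bound /invcheck /compat /capcode;
  computability.
Qed.

Lemma computableb_term : computableb (fun t => term_cert (P t) (y t)).
Proof.
rewrite /term_cert /inv_ok /rank_cert /rank_ok /edge_in /vedge /esrc /edst.
rewrite /in_table /bound /invcheck /compat /capcode; computability.
Qed.

End Computability.
End Certificates.

(** * Correctness of the certificates *)

Lemma eventually_backward nD n Post (U : 'I_nD * multiset n -> Prop) c :
  backward Post U -> eventually Post U c -> U c.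
Proof. by move=> back; elim=> // c1 c2 s12 _; exact: back s12. Qed.

Lemma uniform_bound N (Q : nat -> nat -> Prop) :
  (forall i, i < N -> exists y0, forall y, y0 <= y -> Q i y) ->
  exists y0, forall i y, i < N -> y0 <= y -> Q i y.
Proof.
move=> H; have /choice[f Hf] i : exists y0, i < N -> forall y, y0 <= y -> Q i y.
  by case: (ltnP i N) => [/H[y0]|_]; [exists y0 | exists 0].
exists (\max_(i < N) f i) => i y lt_i le_y; apply: Hf => //.
exact: leq_trans (leq_bigmax (Ordinal lt_i)) le_y.
Qed.

(** Every large base works, so that several functions can share one. *)
Lemma digits_code (f : nat -> nat) n :
  exists b0, forall b, b0 <= b -> exists x, forall t, t < n -> dig b t x = f t.
Proof.
have [b0 Hb0] := @uniform_bound n (fun t b => f t < b) (fun t _ =>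
  ex_intro _ (f t).+1 (fun _ => id)).
by exists b0 => b le_b; exists (num b n f) => t lt_t; apply: dig_num => // s /Hb0;
  exact.
Qed.

Lemma eq_bA n (P Q : nat -> bool) :
  (forall i, i < n -> P i = Q i) -> bA n P = bA n Q.
Proof. by move=> E; apply: eq_in_all => i; rewrite mem_iota => /E. Qed.

Lemma eq_bE n (P Q : nat -> bool) :
  (forall i, i < n -> P i = Q i) -> bE n P = bE n Q.
Proof. by move=> E; apply: eq_in_has => i; rewrite mem_iota => /E. Qed.

(** A coded sequence agrees with the original one only up to position [l]. *)
Lemma eq_pathcheck K n O d0 m0 l D X D' X' :
  (forall i, i <= l -> D i = D' i) -> (forall i, i <= l -> X i = X' i) ->
  pathcheck K n O d0 m0 l D X = pathcheck K n O d0 m0 l D' X'.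
Proof.
move=> ED EX; rewrite /pathcheck ED // EX //; congr (_ && _).
by apply: eq_bA => i lt_i; rewrite ED ?(ltnW lt_i) // EX ?(ltnW lt_i) // ED // EX.
Qed.

Lemma eq_rank_ok K n B F F' lam lam' pi pi' chi chi' : n <= B ->
  (forall e, e < B ^ 6 -> F e = F' e) ->
  (forall t, t < B -> lam t = lam' t) -> (forall v, v < B ^ 2 -> pi v = pi' v) ->
  (forall v, v < B ^ 2 -> chi v = chi' v) ->
  rank_ok K n B F lam pi chi = rank_ok K n B F' lam' pi' chi'.
Proof.
move=> le_nB EF El Ep Ec.
have [->|B0] := posnP B; first by rewrite /rank_ok !exp0n.
have bnd a b : dig B a b < B by rewrite ltn_mod.
have bnd2 a b c d : dig B a b + dig B c d * B < B ^ 2.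
  by have := bnd a b; have := bnd c d; rewrite expnS expn1; nia.
have Es t : t < n -> lam t = lam' t by move=> lt_t; apply: El; exact: leq_trans
  lt_t _.
have ES e : bS n (fun t => lam t * dig K.+1 t (dig B 3 e)) =
            bS n (fun t => lam' t * dig K.+1 t (dig B 3 e)).
  by apply: eq_bigr => t _; rewrite (Es t).
rewrite /rank_ok; congr (_ && _ || _ && _).
- apply: eq_bA => e lt_e; rewrite EF // ES El // !Ep ?bnd2 //.
  by congr (_ ==> _ && _); apply: eq_bA => t lt_t; rewrite (Es t).
- by apply: eq_bE => e lt_e; rewrite EF // ES El // !Ep ?bnd2.
- by apply: eq_bA => e lt_e; rewrite EF // !Ec ?bnd2.
apply: eq_bE => e lt_e; apply: eq_bE => e' lt_e'.
by rewrite EF // EF // !Ec ?bnd2.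
Qed.

Lemma cap_threshold nD n (U : 'I_nD * multiset n -> Prop) : upward U ->
  exists K0, forall K d m, K0 <= K -> U (d, m) -> U (d, mcap K m).
Proof.
move=> up.
have /choice[f Hf] d : exists K0, forall K m, K0 <= K -> U (d, m) -> U (d, mcap K
  m).
  by apply: upward_closed_cap => m m' le_m; apply: up; split.
exists (\max_d f d) => K d m le_K; apply: Hf; exact: leq_trans (leq_bigmax d) le_K.
Qed.

(** The bags that no posted bag dominates form an upward closed set, so membership in it passes to
    caps at large thresholds. *)
Lemma pump_of_cap nD n (Post : 'I_nD -> 'I_n -> 'I_nD -> multiset n -> Prop) d s d'
  :
  exists K1, forall k v N, K1 <= k -> Post d s d' v ->
    exists2 v', Post d s d' v' &
      forall t, (v t < k -> v t <= v' t) /\ (k <= v t -> N <= v' t).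
Proof.
have [m m' le_m nP|K1 HK1] := @upward_closed_cap n
    (fun v => ~ exists2 v', Post d s d' v' & mle v v').
  by move=> [v' Pv' le_v']; apply: nP; exists v' => // t; exact: leq_trans (le_v'
    t).
exists K1 => k v N le_k Pv.
(* The cap of [w] at [k] is below the posted bag [v]; hence [w] itself is dominated by some posted
   bag. *)
pose w : multiset n := [ffun t => if v t < k then v t else v t + N].
have [v' Pv' le_w] : exists2 v', Post d s d' v' & mle w v'.
  apply: contrapT => /(HK1 _ _ le_k); apply; exists v => // t.
  by rewrite !ffunE minnE; case: ifP; lia.
exists v' => // t; have := le_w t; rewrite ffunE; case: ltnP; lia.
Qed.

Lemma pump_threshold nD n (Post : 'I_nD -> 'I_n -> 'I_nD -> multiset n -> Prop) :
  exists K0, forall K d s d' v N, K0 <= K -> Post d s d' v ->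
    exists2 v', Post d s d' v' &
      forall t, (v t < K -> v t <= v' t) /\ (K <= v t -> N <= v' t).
Proof.
have /choice[f Hf] (c : 'I_nD * 'I_n * 'I_nD) := pump_of_cap Post c.1.1 c.1.2 c.2.
exists (\max_c f c) => K d s d' v N le_K.
apply: (Hf (d, s, d')); exact: leq_trans (leq_bigmax (d, s, d')) le_K.
Qed.

Section Correctness.
Variables (C : language_class) (P : async_program C).
Notation nD := (num_states P).
Notation n := (num_handlers P).
Notation Post := (@post C P).
Notation c0 := (init_config P).

Lemma path_ok_sound K l b D X : path_ok P K l b D X ->
  exists g : nat -> config P, [/\ g 0 = c0, forall i, i < l -> step Post (g i) (g
    i.+1) &
    forall i, i <= l -> (g i).1 = dig b i D :> nat /\ (g i).2 = vec K n (dig b i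
      X)].
Proof.
case/andP=> K0; exact: (@path_sound _ _ _ _ _ K0 (@oracleP _ P K) c0).
Qed.

Lemma path_ok_complete (g : nat -> config P) l : g 0 = c0 ->
  (forall i, i < l -> step Post (g i) (g i.+1)) ->
  exists K b D X, path_ok P K l b D X /\
    forall i, i <= l -> dig b i D = (g i).1 /\ vec K n (dig b i X) = (g i).2.
Proof.
move=> g0 gS.
have /choice[v Hv] i : exists v, i < l -> exists s, fires Post (g i) s v (g i.+1).
  by case: (ltnP i l) => [/gS[s [v Hv]]|_]; [exists v => _; exists s | exists
    [ffun=> 0]].
(* [K] exceeds every multiplicity visited or posted on the path, so that capping at [K] loses
   nothing. *)
pose K := (\max_(i < l.+1) \max_t (maxn ((g i).2 t) (v i t))).+1.
have HK i t : i <= l -> (g i).2 t < K /\ v i t < K.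
  move=> le_i; have : \max_t (maxn ((g i).2 t) (v i t)) < K.
    exact: (leq_bigmax (Ordinal (le_i : i < l.+1))).
  have := leq_bigmax t (F := fun t => maxn ((g i).2 t) (v i t)); rewrite geq_max.
  by move=> /andP[Hg Hw] lt_K; split; apply: leq_ltn_trans lt_K.
have K0 : 0 < K by [].
have vecE i : i <= l -> vec K n (bagcode K (g i).2) = (g i).2.
  move=> le_i; apply/ffunP => t; rewrite ffunE dig_bagcode; apply/minn_idPr.
  by have [/ltnW] := HK i t le_i.
have Hp : pathcheck K n (oracle P K) (init_state P) (fnat (init_bag P)) l
    (fun i => (g i).1) (fun i => bagcode K (g i).2).
  have := @path_complete _ _ _ _ _ K0 (@oracleP _ P K) g l; rewrite g0; apply.
    by move=> i le_i t; have [/ltnW] := HK i t le_i.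
  move=> i lt_i; have [s Hs] := Hv i lt_i; exists s, (v i); split=> // t.
  by have [] := HK i t (ltnW lt_i).
have [b1 Hb1] := digits_code (fun i => (g i).1) l.+1.
have [b2 Hb2] := digits_code (fun i => bagcode K (g i).2) l.+1.
have [D HD] := Hb1 _ (leq_maxl b1 b2); have [X HX] := Hb2 _ (leq_maxr b1 b2).
exists K, (maxn b1 b2), D, X; split=> [|i le_i]; last by rewrite HD // HX // vecE.
by rewrite /path_ok K0 (eq_pathcheck _ _ _ _ _ HD HX).
Qed.

Lemma bE5 y (Q : nat -> nat -> nat -> nat -> nat -> bool) :
  bE y (fun a => bE y (fun b => bE y (fun c => bE y (fun d => bE y (Q a b c d)))))
  <-> exists a b c d e, [/\ a < y, b < y, c < y, d < y & e < y /\ Q a b c d e].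
Proof.
split.
  move=> /bEP[a ? /bEP[b ? /bEP[c ? /bEP[d ? /bEP[e ? ?]]]]].
  by exists a, b, c, d, e.
move=> [a [b [c [d [e [? ? ? ? [? ?]]]]]]].
apply/bEP; exists a => //; apply/bEP; exists b => //; apply/bEP; exists c => //.
by apply/bEP; exists d => //; apply/bEP; exists e.
Qed.

Lemma unsafe_sound df y : unsafe_cert P df y ->
  eventually Post (fun c => c.1 = df :> nat) c0.
Proof.
move=> /bE5[K [l [b [D [X [_ _ _ _ [_ /andP[/path_ok_sound[g [g0 gS gE]] /eqP
  El]]]]]]]].
by rewrite -g0; apply: path_eventually gS _; rewrite (gE l _).1.
Qed.

Lemma unsafe_complete df : eventually Post (fun c => c.1 = df :> nat) c0 ->
  exists y, unsafe_cert P df y.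
Proof.
move=> /eventually_path[l [g [g0 gS gl]]].
have [K [b [D [X [Hp HE]]]]] := path_ok_complete g0 gS.
exists (K + l + b + D + X).+1; apply/bE5; exists K, l, b, D, X; split; try lia.
by split; [lia | rewrite Hp (HE l _).1 // gl eqxx].
Qed.

Lemma loop_sound y : loop_cert P y -> diverges Post c0.
Proof.
move=> /bE5[K [l [b [D [X [_ _ _ _ [_ /andP[/path_ok_sound[g [g0 gS gE]]]]]]]]]].
move=> /bEP[i lt_i /andP[/eqP ED /bAP Hle]].
have Di : diverges Post (g i).
  apply: (self_covering_diverges (gS i lt_i)).
  have := @path_eventually _ _ Post (cle (g i)) (fun j => g (i.+1 + j)) (l - i.+1).
  rewrite addn0; apply=> [j lt_j|]; first by rewrite addnS; apply: gS; lia.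
  rewrite subnKC //; split.
    by apply: val_inj; rewrite /= (gE i (ltnW lt_i)).1 (gE l _).1.
  move=> t; rewrite (gE i (ltnW lt_i)).2 (gE l _).2 // !ffunE; exact: Hle.
rewrite -g0; apply: (eventually_backward (@diverges_backward _ _ Post)).
by apply: (@path_eventually _ _ _ _ _ i) => // j lt_j; apply: gS; exact: ltn_trans
  lt_i.
Qed.

Lemma loop_complete : diverges Post c0 -> exists y, loop_cert P y.
Proof.
move=> [g [g0 gS]]; have [i [l [lt_il [E1 E2]]]] := diverges_self_covering gS.
have [K [b [D [X [Hp HE]]]]] := path_ok_complete g0 (fun i (_ : i < l) => gS i).
exists (K + l + b + D + X).+1; apply/bE5; exists K, l, b, D, X; split; try lia.
split; [lia | rewrite Hp /=].
apply/bEP; exists i => //; rewrite (HE i (ltnW lt_il)).1 (HE l _).1 // E1 eqxx /=.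
apply/bAP => t lt_t; have := E2 (Ordinal lt_t).
by rewrite -(HE i (ltnW lt_il)).2 -(HE l _).2 // !ffunE.
Qed.

Lemma boundP K : [/\ nD <= bound P K, n <= bound P K & K.+1 ^ n <= bound P K].
Proof. by rewrite /bound; split; lia. Qed.

Lemma inv_ok_run K I (g : nat -> config P) l : inv_ok P K I -> g 0 = c0 ->
  (forall i, i < l -> step Post (g i) (g i.+1)) ->
  in_table P K I (g l).1 (bagcode K (g l).2).
Proof.
move=> /andP[K0 inv] g0 gS; elim: l gS => [|l IH] gS.
  by rewrite g0; case/andP: inv.
have [s [v Hf]] := gS l (ltnSn l).
apply: (inv_step K0 (@oracleP _ P K) inv Hf); apply: IH => i lt_i; apply: gS.
exact: ltnW.
Qed.

Lemma safe_sound df y : safe_cert P df y ->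
  ~ eventually Post (fun c => c.1 = df :> nat) c0.
Proof.
move=> /bEP[K _ /bEP[I _ /andP[inv /bAP H]]] /eventually_path[l [g [g0 gS gl]]].
have := inv_ok_run inv g0 gS; rewrite gl; apply/negP/H; exact: capcode_lt.
Qed.

Lemma table_code K (R : nat -> nat -> bool) : exists I,
  forall d x, d < bound P K -> x < bound P K -> in_table P K I d x = R d x.
Proof.
pose B := bound P K; pose f v : nat := R (v %% B) (v %/ B).
exists (num 2 (B ^ 2) f) => d x lt_d lt_x; rewrite /in_table.
have B0 : 0 < B by exact: leq_ltn_trans lt_d.
have lt_v : d + x * B < B ^ 2 by rewrite expnS expn1; nia.
rewrite dig_num // => [|s _]; last by rewrite /f; case: (R _ _).
rewrite /f addnC modnMDl divnMDl // modn_small // divn_small // addn0.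
by case: (R d x).
Qed.

Lemma inv_ok_complete (U : config P -> Prop) K :
  upward U -> backward Post U -> 0 < K ->
  (forall d m, U (d, m) -> U (d, mcap K m)) -> ~ U c0 ->
  exists2 I, inv_ok P K I & forall (d : 'I_nD) x, x < K.+1 ^ n ->
    in_table P K I d x = `[< ~ U (d, vec K n x) >].
Proof.
move=> up back K0 stab nU; have [BD Bn BM] := boundP K.
have [I HI] := table_code K (fun d x =>
  if insub d is Some d0 then `[< ~ U (d0, vec K n x) >] else false).
have IP (d : 'I_nD) x : x < K.+1 ^ n ->
    in_table P K I d x = `[< ~ U (d, vec K n x) >].
  move=> lt_x; rewrite HI ?valK //; first exact: leq_trans (ltn_ord d) BD.
  exact: leq_trans lt_x BM.
exists I => //; rewrite /inv_ok K0.
exact: (inv_complete K0 (@oracleP _ P K) up back stab IP nU).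
Qed.

Lemma safe_complete df : ~ eventually Post (fun c => c.1 = df :> nat) c0 -> df < nD
  ->
  exists y, safe_cert P df y.
Proof.
move=> nE lt_df; pose U := eventually Post (fun c => c.1 = df :> nat).
have up : upward U by apply: eventually_upward => c c' [<-].
have back : backward Post U by move=> c c'; exact: Ev_step.
have [k0 stab] := cap_threshold up.
have [I inv HI] := @inv_ok_complete U k0.+1 up back isT
  (fun d m => stab _ d m (leqnSn k0)) nE.
exists (k0.+1 + I).+1; apply/bEP; exists k0.+1; first by lia.
apply/bEP; exists I; first by lia.
rewrite inv; apply/bAP => x lt_x.
rewrite (HI (Ordinal lt_df)) //; apply/asboolPn; apply; exact: Ev_now.
Qed.

Lemma term_sound y : term_cert P y -> ~ diverges Post c0.
Proof.
move=> /bEP[K _ /bEP[I _ /andP[/andP[K0 inv] /bAP Hrank]]] [g [g0 gS]].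
have [BD Bn BM] := boundP K; set B := bound P K in BD Bn BM Hrank *.
have inv' : invcheck K nD n (oracle P K) (g 0).1 (bagcode K (g 0).2) (in_table P K
  I).
  by rewrite g0.
have [F [e lt_e Fe] HF] := rank_sound K0 (@oracleP _ P K) BD Bn BM inv' gS.
(* The bits of [F] form a number below [2 ^ (B ^ 6)], so the certificate contains a ranking for
   [F]. *)
pose f x : nat := F x.
have f2 s : s < B ^ 6 -> f s < 2 by rewrite /f; case: (F s).
have EF x : x < B ^ 6 -> edge_in P K I (num 2 (B ^ 6) f) x =
    F x && vedge K n (oracle P K) (in_table P K I) B x.
  by move=> lt_x; rewrite /edge_in dig_num // /f; case: (F x).
have /implyP Himp := Hrank (num 2 (B ^ 6) f) (num_lt f2).
have /Himp/bEP[b _ /bEP[lam _ /bEP[pi _ /bEP[chi _]]]] :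
    bE (B ^ 6) (edge_in P K I (num 2 (B ^ 6) f)).
  by apply/bEP; exists e => //; rewrite EF.
apply/negP; rewrite (eq_rank_ok _ Bn EF (fun _ _ => erefl) (fun _ _ => erefl)
  (fun _ _ => erefl)); exact: HF.
Qed.

Lemma term_complete : ~ diverges Post c0 -> exists y, term_cert P y.
Proof.
move=> nD0.
have [k0 stab] := cap_threshold (@diverges_upward _ _ Post).
have [k1 pump] := pump_threshold Post.
pose K := (k0 + k1).+1; have K0 : 0 < K by [].
have le0 : k0 <= K by rewrite /K; lia.
have le1 : k1 <= K by rewrite /K; lia.
have stabK d m := stab K d m le0.
have [I inv HI] := inv_ok_complete (@diverges_upward _ _ Post)
  (@diverges_backward _ _ Post) K0 stabK nD0.
have [BD Bn BM] := boundP K; set B := bound P K in BD Bn BM.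
have pumpK d s d' v N := pump K d s d' v N le1.
(* One bound must serve all of the finitely many edge sets [F]. *)
have [|y0 Hy0] := @uniform_bound (2 ^ (B ^ 6)) (fun F y => rank_cert P K I F y).
  move=> F _; rewrite /rank_cert.
  case: (boolP (bE _ _)) => [/bEP[e lt_e Fe]|_]; last by exists 0.
  have [|lam [pi [chi Hr]]] := rank_complete K0 (@oracleP _ P K) BD Bn BM stabK
    pumpK HI
     (F := fun e => dig 2 e F == 1); first by exists e.
  have [b1 Hb1] := digits_code lam B.
  have [b2 Hb2] := digits_code pi (B ^ 2).
  have [b3 Hb3] := digits_code chi (B ^ 2).
  pose b := b1 + b2 + b3.
  have [x1 E1] : exists x, forall t, t < B -> dig b t x = lam t by apply: Hb1;
    rewrite /b; lia.
  have [x2 E2] : exists x, forall t, t < B ^ 2 -> dig b t x = pi t by apply: Hb2;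
    rewrite /b; lia.
  have [x3 E3] : exists x, forall t, t < B ^ 2 -> dig b t x = chi t by apply: Hb3;
    rewrite /b; lia.
  exists (b + x1 + x2 + x3).+1 => y le_y /=.
  apply/bEP; exists b; first by lia.
  apply/bEP; exists x1; first by lia.
  apply/bEP; exists x2; first by lia.
  apply/bEP; exists x3; first by lia.
  by rewrite (eq_rank_ok _ Bn (fun _ _ => erefl) E1 E2 E3).
exists (K + I + y0).+1; apply/bEP; exists K; first by lia.
apply/bEP; exists I; first by lia.
by rewrite inv; apply/bAP => F lt_F; apply: Hy0 => //; lia.
Qed.

End Correctness.

(** * From emptiness to safety and termination *)

Section FromEmptiness.
Variable C : language_class.
Hypothesis interC : effectively_closed_regular_inter C.
Hypothesis emptyC : emptiness_decidable C.

Lemma termination_of_emptiness : termination_decidable C.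
Proof.
have HP : computablem (fun p : ext (prog C) => p.1 : prog C) by computability.
apply: (@decidable_by_search (prog C) _ (@term_cert C) (@loop_cert C)).
- exact: (computableb_term interC emptyC HP (computable_var _)).
- exact: (computableb_loop interC emptyC HP (computable_var _)).
- by move=> P /terminatingP/term_complete.
- by move=> P nT; apply: loop_complete; apply: contrapT => nD;
  apply/nT/terminatingP.
- by move=> P y /term_sound/terminatingP.
by move=> P y /loop_sound D /terminatingP; apply.
Qed.

Definition safety_instance : ctx :=
  @Ctx {P : async_program C & 'I_(num_states P)}
    (fun x => encode_program (projT1 x) ++ [:: pickle (projT2 x)]) 6 (fun=> erefl).

Lemma safety_of_emptiness : safety_decidable C.
Proof.
pose pP (p : ext safety_instance) : prog C := projT1 p.1.
pose pd (p : ext safety_instance) : nat := projT2 p.1.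
have HP : computablem pP by exists [seq Proj i | i <- iota 1 5] => p; do !split.
have Hd : computable pd by exists (Proj 6) => p.
have reachE (x : safety_instance) :
    (exists m, reachable (projT2 x, m)) <->
    eventually (@post C (projT1 x)) (fun c => c.1 = projT2 x :> nat) (init_config
      _).
  split=> [/reachableP H|H]; last apply/reachableP.
    by apply: eventually_imp H => c ->.
  by apply: eventually_imp H => c; exact: val_inj.
apply: (@decidable_by_search safety_instance _
  (fun x => @unsafe_cert C (projT1 x) (projT2 x))
  (fun x => @safe_cert C (projT1 x) (projT2 x))).
- exact: (@computableb_unsafe C interC emptyC _ pP pd _ HP Hd (computable_var _)).
- exact: (@computableb_safe C interC emptyC _ pP pd _ HP Hd (computable_var _)).
- by move=> x /reachE/unsafe_complete.
- move=> x nR; apply: safe_complete (ltn_ord _) => /reachE; exact: nR.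
- by move=> x y /unsafe_sound/reachE.
by move=> x y /safe_sound nE /reachE.
Qed.

End FromEmptiness.

(** * From safety or termination to emptiness *)

Section Gadget.
Variable C : language_class.

(** State 1 is the target for safety. One task is pending, so the program can move exactly if the
    language of [r] is inhabited. *)
Definition gadget (r : rep C 1) : async_program C :=
  @AsyncProgram C 2 1 (fun _ _ _ => r) ord0 [ffun=> 1].

Lemma encode_gadget (r : rep C 1) : encode_program (gadget r) =
  [:: 2; 1; CodeSeq.code (mkseq (fun _ => CodeSeq.code (mkseq (fun _ =>
    CodeSeq.code (mkseq (fun _ => pickle r) 2)) 1)) 2); 0;
    CodeSeq.code (mkseq (fun _ => 1) 1)].
Proof.
rewrite /encode_program /encode3 /encode1 /=; congr [:: _; _; _; _; _].
  pose c2 := CodeSeq.code (mkseq (fun=> pickle r) 2).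
  apply: (@pickle_codom _ _ _ (fun=> CodeSeq.code (mkseq (fun=> c2) 1))) => _.
  apply: (@pickle_codom _ _ _ (fun=> c2)) => _.
  exact: (@pickle_codom _ _ _ (fun=> pickle r)).
by apply: (@pickle_codom _ _ _ (fun=> 1)) => i; rewrite ffunE.
Qed.

(** The word of length one restores the bag: this is a self-loop if [d] is the initial state, and
    reaches the target otherwise. *)
Lemma gadget_step (r : rep C 1) (d : 'I_2) : (forall u, lang r u) ->
  step (@post C (gadget r)) (init_config (gadget r)) (d, [ffun=> 1]).
Proof.
move=> Lr; exists ord0, [ffun=> 1]; split=> [|| t]; last 2 first.
- by rewrite /= ffunE.
- by rewrite /= !ffunE (ord1 t).
by exists [:: ord0] => //; apply/ffunP => t; rewrite !ffunE /= (ord1 t).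
Qed.

Lemma gadget_stuck (r : rep C 1) c c' : (forall u, ~ lang r u) ->
  ~ step (@post C (gadget r)) c c'.
Proof. by move=> Lr [s [v [[w /Lr]]]]. Qed.

Hypothesis homC : effectively_closed_hom C.
Hypothesis invC : effectively_closed_inverse_hom C.

Definition emptiness_instance : ctx :=
  @Ctx {n : nat & rep C n} (fun x => [:: projT1 x; pickle (projT2 x)]) 2 (fun=>
    erefl).

(** The stages of the reduction are chained through numbers: each takes the code of the
    representation computed by the previous one. *)
Definition numeral : ctx := @Ctx nat (fun p => [:: p]) 1 (fun=> erefl).

Lemma computable_numeral : computable (fun p : numeral => p).
Proof. by exists (Proj 0). Qed.

Lemma compute_gadget : exists f : seq recfun, forall x : emptiness_instance,
  exists r : rep C 1, evals (ctx_enc x) f (encode_program (gadget r)) /\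
    forall u, lang r u <-> exists w, lang (projT2 x) w.
Proof.
have [fh Hfh] := homC; have [fi Hfi] := invC.
have [a1 Ha1] : computablev (fun x : emptiness_instance =>
    [:: projT1 x; 1; pickle (projT2 x); CodeSeq.code (mkseq (fun _ => 0) (projT1
      x))]).
  have H0 : computable (fun x : emptiness_instance => projT1 x) by exists (Proj 0).
  have H1 : computable (fun x : emptiness_instance => pickle (projT2 x)) by exists
    (Proj 1).
  by do !apply: computablev_cons; try exact: computablev_nil; computability.
have [a2 Ha2] : computablev (fun p : numeral => [:: 1; 1; p; CodeSeq.code (mkseq
  (fun _ => 0) 1)]).
  have H0 := computable_numeral.
  by do !apply: computablev_cons; try exact: computablev_nil; computability.
have [a3 Ha3] : computablev (fun p : numeral =>
    [:: 2; 1; CodeSeq.code (mkseq (fun _ => CodeSeq.code (mkseq (fun _ =>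
    CodeSeq.code (mkseq (fun _ => p) 2)) 1)) 2); 0;
    CodeSeq.code (mkseq (fun _ => 1) 1)]).
  have H0 := computable_numeral.
  by do !apply: computablev_cons; try exact: computablev_nil; computability.
pose f2 := Comp fi [seq Comp a [:: Comp fh a1] | a <- a2].
exists [seq Comp a [:: f2] | a <- a3] => -[n r].
have [r1 [E1 L1]] := Hfh n 1 r (fun _ => [::]).
have [r2 [E2 L2]] := Hfi 1 1 r1 (fun _ => [::]).
have nil_ext k l (w : seq 'I_k) : hom_ext (fun _ => [::] : seq 'I_l) w = [::].
  by elim: w.
have evals_comp fs xs zs g x : evals [:: x] fs zs -> eval g xs x ->
    evals xs [seq Comp a [:: g] | a <- fs] zs.
  move=> H Hg; elim: fs zs H => [|a fs IH] [|z zs] //= [Ha /IH Hs].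
  by split=> //; exists [:: x].
exists r2; split=> [|u]; last first.
  rewrite L2 L1; split=> [[w [Hw _]]|[w Hw]]; exists w => //.
  by split; rewrite // !nil_ext.
rewrite encode_gadget; apply: (evals_comp _ _ _ _ _ (Ha3 (pickle r2))).
apply: (@eval_Comp _ _ _ [:: 1; 1; pickle r1; CodeSeq.code (mkseq (fun _ => 0) 1)]).
  apply: (evals_comp _ _ _ _ _ (Ha2 (pickle r1))); apply: eval_Comp (Ha1 (existT _
    n r)) _.
  by rewrite -(@pickle_codom n _ (fun _ => [::] : seq 'I_1) (fun=> 0)).
by rewrite -(@pickle_codom 1 _ (fun _ => [::] : seq 'I_1) (fun=> 0)).
Qed.

Lemma emptiness_of_termination : termination_decidable C -> emptiness_decidable C.
Proof.
have [fs Hfs] := compute_gadget; move=> [f Hf]; exists (Comp f fs) => x.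
have [r [E L]] := Hfs x; have [H1 H0] := Hf (gadget r).
split=> Ex; apply: eval_Comp E _.
  apply/H1/terminatingP => -[g [_ /(_ 0)]]; apply: gadget_stuck => u /L[w].
  exact: Ex.
apply/H0/terminatingP; apply; exists (fun=> init_config (gadget r)); split=> // _.
apply: gadget_step => u; apply/L; apply: contrapT => nL; apply: Ex => w Hw.
by apply: nL; exists w.
Qed.

(** The target is reachable exactly if the language is nonempty, so the answer of the safety
    procedure is negated. *)
Lemma emptiness_of_safety : safety_decidable C -> emptiness_decidable C.
Proof.
have [fs Hfs] := compute_gadget; move=> [f Hf].
have [one Hone] : computable (fun _ : emptiness_instance => 1) by computability.
have [neg Hneg] : computable (fun p : numeral => 1 - p).
  by have H0 := computable_numeral; computability.
exists (Comp neg [:: Comp f (rcons fs one)]) => x.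
have [r [E L]] := Hfs x.
have [H1 H0] := Hf (existT (fun P : async_program C => 'I_(num_states P))
  (gadget r) (Ordinal (isT : 1 < 2))).
have E' : evals (@ctx_enc emptiness_instance x) (rcons fs one) (encode_program
  (gadget r) ++ [:: 1]).
  elim: (fs) (encode_program _) E => [|a l IH] [|z zs] //=; first by split=> //;
    exact: Hone.
  by move=> [Ha /IH].
split=> Ex.
  exists [:: 0]; split; last exact: (Hneg 0).
  split=> //; apply: eval_Comp E' _; apply: H0 => /reachableP Ev.
  inversion Ev as [c Ec|c c' Hs _].
    by [].
  by apply: gadget_stuck Hs => u /L[w]; exact: Ex.
exists [:: 1]; split; last exact: (Hneg 1).
split=> //; apply: eval_Comp E' _; apply/H1/reachableP.
apply: Ev_step (gadget_step _ _) (Ev_now _ _) => // u.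
apply/L; apply: contrapT => nL; apply: Ex => w Hw.
by apply: nL; exists w.
Qed.

End Gadget.

Theorem theorem4p2 (C : language_class) (hC : full_trio C) :
  (safety_decidable C <-> termination_decidable C) /\
  (termination_decidable C <-> emptiness_decidable C).
Proof.
have [interC homC invC] := hC.
have TE := emptiness_of_termination homC invC.
have SE := emptiness_of_safety homC invC.
have ET := termination_of_emptiness interC.
have ES := safety_of_emptiness interC.
by split; [split=> [/SE/ET|/TE/ES] | split].
Qed.
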